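(* Let $\mathsf{k}$ be a field and let $T=(F,E,p,q)$ be a left-resolving textile system such that $F,E$ are finite graphs without sinks, $p,q$ are surjective and $p$ has $s$-path lifting. Then there is an injective $\mathbb{Z}$-graded $\mathsf{k}$-algebra homomorphism $\Phi:L(\Delta_T)\to\mathbf{A}(T)$ from the Leavitt path algebra of the diagonal graph $\Delta_T$ to the textile algebra of $T$ which, when restricted to the diagonal subalgebra $\mathcal{D}(\Delta_T)$ of $L(\Delta_T)$, gives an isomorphism between $\mathcal{D}(\Delta_T)$ and $\mathfrak{D}(T)$.
   Context: A directed graph is written $E=(E^0,E^1,r_E,s_E)$ (vertices, edges, range, source). A sink is a vertex emitting no edge. A graph homomorphism $f:F\to E$ is a pair $(f^0,f^1)$, $f^i:F^i\to E^i$, commuting with ranges and sources (superscripts are often dropped); it is surjective if both $f^0$ and $f^1$ are. A textile system is $T=(F,E,p,q)$ with $F,E$ directed graphs and $p,q:F\to E$ graph homomorphisms such that $f\mapsto (s_F(f),r_F(f),p(f),q(f))$ is injective on $F^1$. A homomorphism $p:F\to E$ has $r$-path lifting (resp. $s$-path lifting) if whenever $v\in F^0$, $e\in E^1$ and $p^0(v)=r_E(e)$ (resp. $p^0(v)=s_E(e)$), there is $f\in F^1$ with $r_F(f)=v$ (resp. $s_F(f)=v$) and $p^1(f)=e$; the lifting is unique if such $f$ is always unique. $T$ is left-resolving if $p$ has unique $r$-path lifting and $q$ has unique $s$-path lifting. The textile algebra $\mathbf{A}(T)$ is the associative (not necessarily unital) $\mathsf{k}$-algebra generated by $E^0\cup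 F^0\cup E^1\cup\{w^*\mid w\in F^0\}\cup\{e^*\mid e\in E^1\}$ subject to: (T1) $uv=\delta_{u,v}u$ for $u,v\in E^0$; (T2) $s_E(e)e=e=e\,r_E(e)$ and $r_E(e)e^*=e^*=e^*s_E(e)$ for $e\in E^1$; $p(w)w=w=w\,q(w)$ and $q(w)w^*=w^*=w^*p(w)$ for $w\in F^0$; (T3) $e^*e'=\delta_{e,e'}r_E(e)$ for $e,e'\in E^1$; $w^*w'=\delta_{w,w'}q(w)$ for $w,w'\in F^0$; (T4) $u=\sum_{e\in s_E^{-1}(u)}ee^*$ for $u\in E^0$ with $0<|s_E^{-1}(u)|<\infty$; $v=\sum_{w\in F^0,\,p(w)=v}ww^*$ for $v\in E^0$ with $0<|(p^0)^{-1}(v)|<\infty$; (T5) $we=e'w'$ and $e^*w^*=w'^*e'^*$ whenever there is $f\in F^1$ with $w=s_F(f)$, $w'=r_F(f)$, $e=q(f)$, $e'=p(f)$. It is $\mathbb{Z}$-graded by $\deg v=0$, $\deg w=\deg w^*=0$, $\deg e=1$, $\deg e^*=-1$ for $v\in E^0,w\in F^0,e\in E^1$. $\mathfrak{D}(T)$, the diagonal subalgebra of $\mathbf{A}(T)$, is the subalgebra generated by the elements $\alpha\alpha^*$ where $\alpha$ runs over all products of elements of $F^0\cup E^1$ (including the length-zero ones $\alpha=v\in E^0$, with $v^*=v$) that are nonzero in $\mathbf{A}(T)$; for $\alpha=x_1\cdots x_n$, $\alpha^*:=x_n^*\cdots x_1^*$. The diagonal graph is $\Delta_T:=(E^0,F^1,r_E\circ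 q,s_E\circ p)$. The Leavitt path algebra $L(\Delta)=L_{\mathsf{k}}(\Delta)$ of a directed graph $\Delta$ is the $\mathsf{k}$-algebra generated by $\Delta^0\cup\Delta^1\cup\{f^*\mid f\in\Delta^1\}$ with relations $uv=\delta_{u,v}u$, $s(f)f=f=f\,r(f)$, $r(f)f^*=f^*=f^*s(f)$, $f^*g=\delta_{f,g}r(f)$, and $v=\sum_{s(f)=v}ff^*$ when $0<|s^{-1}(v)|<\infty$; it is $\mathbb{Z}$-graded by $\deg v=0$, $\deg f=1$, $\deg f^*=-1$. Its diagonal subalgebra $\mathcal{D}(\Delta)$ is the linear span of the elements $\alpha\alpha^*$, $\alpha$ a finite path in $\Delta$ (vertices included). *)

(* Defs.v *)
From HB Require Import structures.
From mathcomp Require Import all_boot all_order all_algebra.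
From mathcomp Require Import boolp classical_sets functions cardinality.

Set Implicit Arguments.
Unset Strict Implicit.
Unset Printing Implicit Defensive.

Import GRing.Theory.
Local Open Scope classical_set_scope.
Local Open Scope ring_scope.
Local Open Scope quotient_scope.

(* Associative, not necessarily unital algebras: the product is [( _ * _ )%g]
   of the semigroup structure. *)
HB.mixin Record LmodSemigroup_isNUAlgebra (k : pzRingType) A
    of GRing.Lmodule k A & Semigroup A := {
  numulDl : forall x y z : A, ((x + y)%R * z)%g = (x * z)%g + (y * z)%g;
  numulDr : forall x y z : A, (x * (y + z)%R)%g = (x * y)%g + (x * z)%g;
  numulZl : forall (a : k) (x y : A), ((a *: x) * y)%g = a *: (x * y)%g;
  numulZr : forall (a : k) (x y : A), (x * (a *: y))%g = a *: (x * y)%g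
}.

#[short(type="nuAlgType")]
HB.structure Definition NUAlgebra (k : pzRingType) :=
  {A of LmodSemigroup_isNUAlgebra k A & GRing.Lmodule k A & Semigroup A}.

Section NUAlgebraTheory.
Variables (k : fieldType) (A : nuAlgType k).

Definition lspan (S : set A) : set A :=
  smallest [set V : set A | submod_closed (mem V)] S.

Definition subalg_gen (S : set A) : set A :=
  smallest [set V : set A | submod_closed (mem V) /\ mulg_closed (mem V)] S.

(* x_0 x_1 ... x_n, for the nonempty word x :: s = [:: x_0; ...; x_n] *)
Definition nuprod (x : A) (s : seq A) : A := foldl (fun a y => (a * y)%g) x s.

(* x_n ... x_1 x_0 *)
Definition nuprod_rev (x : A) (s : seq A) : A :=
  foldl (fun a y => (y * a)%g) x s.

End NUAlgebraTheory.

(* The algebra over k generated by X subject to a set of relations: formal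
   expressions in the generators, modulo the least congruence that contains
   the relations and the axioms of associative k-algebras. *)
Section Presentation.
Variables (k : fieldType) (X : Type).

Inductive term : Type :=
| Gen of X
| Zero
| Add of term & term
| Scale of k & term
| Mul of term & term.

HB.instance Definition _ := gen_eqMixin term.
HB.instance Definition _ := gen_choiceMixin term.

Definition tsum (s : seq term) : term := foldr Add Zero s.

Variable rel : term -> term -> Prop.

Inductive cong : term -> term -> Prop :=
| cong_rel s t : rel s t -> cong s t
| cong_refl t : cong t t
| cong_sym s t : cong s t -> cong t s
| cong_trans s t u : cong s t -> cong t u -> cong s u
| cong_add s s' t t' : cong s s' -> cong t t' -> cong (Add s t) (Add s' t')
| cong_scale a s s' : cong s s' -> cong (Scale a s) (Scale a s')
| cong_mul s s' t t' : cong s s' -> cong t t' -> cong (Mul s t) (Mul s' t')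
| cong_addA s t u : cong (Add s (Add t u)) (Add (Add s t) u)
| cong_addC s t : cong (Add s t) (Add t s)
| cong_add0 t : cong (Add Zero t) t
| cong_addN t : cong (Add (Scale (-1) t) t) Zero
| cong_scaleA a b t : cong (Scale a (Scale b t)) (Scale (a * b) t)
| cong_scale1 t : cong (Scale 1 t) t
| cong_scaleDr a s t : cong (Scale a (Add s t)) (Add (Scale a s) (Scale a t))
| cong_scaleDl a b t : cong (Scale (a + b) t) (Add (Scale a t) (Scale b t))
| cong_mulA s t u : cong (Mul s (Mul t u)) (Mul (Mul s t) u)
| cong_mulDl s t u : cong (Mul (Add s t) u) (Add (Mul s u) (Mul t u))
| cong_mulDr s t u : cong (Mul s (Add t u)) (Add (Mul s t) (Mul s u))
| cong_mulZl a s t : cong (Mul (Scale a s) t) (Scale a (Mul s t))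
| cong_mulZr a s t : cong (Mul s (Scale a t)) (Scale a (Mul s t)).

Definition congb (s t : term) : bool := `[< cong s t >].

Lemma congb_refl : reflexive congb.
Proof. by move=> t; apply/asboolP; apply: cong_refl. Qed.

Lemma congb_sym : symmetric congb.
Proof. by move=> s t; apply/asboolP/asboolP; apply: cong_sym. Qed.

Lemma congb_trans : transitive congb.
Proof.
by move=> t s u /asboolP st /asboolP tu; apply/asboolP; apply: cong_trans tu.
Qed.

Canonical congb_equiv := EquivRel congb congb_refl congb_sym congb_trans.

Definition presalg := {eq_quot congb_equiv}.

HB.instance Definition _ := Choice.on presalg.

Definition proj (t : term) : presalg := \pi_({eq_quot congb_equiv}) t.

Definition gen (x : X) : presalg := proj (Gen x).

Lemma proj_eq s t : (proj s = proj t) <-> cong s t.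
Proof.
split=> [/eqquotP/asboolP //|st]; exact/eqquotP/asboolP.
Qed.

Lemma projK (x : presalg) : proj (repr x) = x.
Proof. exact: reprK. Qed.

Lemma repr_proj t : cong (repr (proj t)) t.
Proof. by apply/proj_eq; rewrite projK. Qed.

Lemma projW (P : presalg -> Prop) : (forall t, P (proj t)) -> forall x, P x.
Proof. by move=> H x; rewrite -(projK x). Qed.

Definition padd (x y : presalg) : presalg := proj (Add (repr x) (repr y)).
Definition popp (x : presalg) : presalg := proj (Scale (-1) (repr x)).
Definition pscale (a : k) (x : presalg) : presalg := proj (Scale a (repr x)).
Definition pmul (x y : presalg) : presalg := proj (Mul (repr x) (repr y)).

Lemma proj_add s t : padd (proj s) (proj t) = proj (Add s t).
Proof. by apply/proj_eq; apply: cong_add; apply: repr_proj. Qed.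

Lemma proj_opp t : popp (proj t) = proj (Scale (-1) t).
Proof. by apply/proj_eq; apply: cong_scale; apply: repr_proj. Qed.

Lemma proj_scale a t : pscale a (proj t) = proj (Scale a t).
Proof. by apply/proj_eq; apply: cong_scale; apply: repr_proj. Qed.

Lemma proj_mul s t : pmul (proj s) (proj t) = proj (Mul s t).
Proof. by apply/proj_eq; apply: cong_mul; apply: repr_proj. Qed.

Lemma paddA : associative padd.
Proof.
elim/projW=> s; elim/projW=> t; elim/projW=> u.
by rewrite !proj_add; apply/proj_eq; apply: cong_addA.
Qed.

Lemma paddC : commutative padd.
Proof.
elim/projW=> s; elim/projW=> t.
by rewrite !proj_add; apply/proj_eq; apply: cong_addC.
Qed.

Lemma padd0 : left_id (proj Zero) padd.
Proof.
by elim/projW=> t; rewrite proj_add; apply/proj_eq; apply: cong_add0.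
Qed.

Lemma paddN : left_inverse (proj Zero) popp padd.
Proof.
elim/projW=> t; rewrite proj_opp proj_add.
by apply/proj_eq; apply: cong_addN.
Qed.

HB.instance Definition _ :=
  GRing.isZmodule.Build presalg paddA paddC padd0 paddN.

Lemma pscaleA a b x : pscale a (pscale b x) = pscale (a * b) x.
Proof.
elim/projW: x => t; rewrite !proj_scale.
by apply/proj_eq; apply: cong_scaleA.
Qed.

Lemma pscale1 : left_id 1 pscale.
Proof.
by elim/projW=> t; rewrite proj_scale; apply/proj_eq; apply: cong_scale1.
Qed.

Lemma pscaleDr : right_distributive pscale +%R.
Proof.
move=> a; elim/projW=> s; elim/projW=> t.
rewrite [proj s + _]proj_add !proj_scale [_ + _]proj_add.
by apply/proj_eq; apply: cong_scaleDr.
Qed.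

Lemma pscaleDl x : {morph pscale^~ x : a b / a + b}.
Proof.
move=> a b; elim/projW: x => t.
rewrite !proj_scale [_ + _ in RHS]proj_add.
by apply/proj_eq; apply: cong_scaleDl.
Qed.

HB.instance Definition _ := GRing.Zmodule_isLmodule.Build k presalg
  pscaleA pscale1 pscaleDr pscaleDl.

Lemma pmulA : associative pmul.
Proof.
elim/projW=> s; elim/projW=> t; elim/projW=> u.
by rewrite !proj_mul; apply/proj_eq; apply: cong_mulA.
Qed.

HB.instance Definition _ := isSemigroup.Build presalg pmulA.

Lemma pmulDl (x y z : presalg) : ((x + y)%R * z)%g = (x * z)%g + (y * z)%g.
Proof.
elim/projW: x => s; elim/projW: y => t; elim/projW: z => u.
rewrite [proj s + _]proj_add [LHS]proj_mul.
rewrite [(proj s * _)%g]proj_mul [(proj t * _)%g]proj_mul [RHS]proj_add.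
by apply/proj_eq; apply: cong_mulDl.
Qed.

Lemma pmulDr (x y z : presalg) : (x * (y + z)%R)%g = (x * y)%g + (x * z)%g.
Proof.
elim/projW: x => s; elim/projW: y => t; elim/projW: z => u.
rewrite [proj t + _]proj_add [LHS]proj_mul.
rewrite [(_ * proj t)%g]proj_mul [(_ * proj u)%g]proj_mul [RHS]proj_add.
by apply/proj_eq; apply: cong_mulDr.
Qed.

Lemma pmulZl a (x y : presalg) : ((a *: x) * y)%g = a *: (x * y)%g.
Proof.
elim/projW: x => s; elim/projW: y => t.
rewrite [a *: proj s]proj_scale [LHS]proj_mul [(_ * _)%g]proj_mul.
by rewrite [RHS]proj_scale; apply/proj_eq; apply: cong_mulZl.
Qed.

Lemma pmulZr a (x y : presalg) : (x * (a *: y))%g = a *: (x * y)%g.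
Proof.
elim/projW: x => s; elim/projW: y => t.
rewrite [a *: proj t]proj_scale [LHS]proj_mul [(_ * _)%g]proj_mul.
by rewrite [RHS]proj_scale; apply/proj_eq; apply: cong_mulZr.
Qed.

HB.instance Definition _ := LmodSemigroup_isNUAlgebra.Build k presalg
  pmulDl pmulDr pmulZl pmulZr.

(* The homogeneous component of degree n, when generators have degree deg. *)
Definition homog (deg : X -> int) (n : int) : set presalg :=
  lspan [set a : presalg | exists (x : X) (s : seq X),
           \sum_(y <- x :: s) deg y = n /\ a = nuprod (gen x) (map gen s)].

End Presentation.

Arguments homog {k X} rel deg n.
Arguments Zero {k X}.
Arguments Gen {k X} _.

Record digraph := Digraph {
  vert : choiceType;
  edge : choiceType;
  rng : edge -> vert;
  src : edge -> vert
}.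

Record ghom (F E : digraph) := GHom {
  hvert : vert F -> vert E;
  hedge : edge F -> edge E;
  hom_rng : forall f, rng (hedge f) = hvert (rng f);
  hom_src : forall f, src (hedge f) = hvert (src f)
}.

Definition finite_graph (E : digraph) : Prop :=
  finite_set [set: vert E] /\ finite_set [set: edge E].

Definition is_sink (E : digraph) (v : vert E) : Prop :=
  forall e : edge E, src e <> v.

Definition ghom_surjective (F E : digraph) (h : ghom F E) : Prop :=
  (forall v, exists w, hvert h w = v) /\ (forall e, exists f, hedge h f = e).

Section PathLifting.
Variables (F E : digraph) (h : ghom F E).

Definition r_path_lifting : Prop := forall v e, hvert h v = rng e ->
  exists f, rng f = v /\ hedge h f = e.

Definition s_path_lifting : Prop := forall v e, hvert h v = src e ->
  exists f, src f = v /\ hedge h f = e.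

Definition unique_r_path_lifting : Prop := forall v e, hvert h v = rng e ->
  exists! f, rng f = v /\ hedge h f = e.

Definition unique_s_path_lifting : Prop := forall v e, hvert h v = src e ->
  exists! f, src f = v /\ hedge h f = e.

End PathLifting.

Record textile_system := TextileSystem {
  tF : digraph;
  tE : digraph;
  tp : ghom tF tE;
  tq : ghom tF tE;
  textile_inj :
    injective (fun f : edge tF => (src f, rng f, hedge tp f, hedge tq f))
}.

Definition left_resolving (T : textile_system) : Prop :=
  unique_r_path_lifting (tp T) /\ unique_s_path_lifting (tq T).

Definition diagonal_graph (T : textile_system) : digraph :=
  @Digraph (vert (tE T)) (edge (tF T))
    (fun f => rng (hedge (tq T) f)) (fun f => src (hedge (tp T) f)).

(* In a relation u = \sum_(x in P) ..., a nonempty duplicate-free sequence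
   enumerating P exists exactly when 0 < |P| < oo. *)
Definition enumerates (I : eqType) (s : seq I) (P : I -> Prop) : Prop :=
  [/\ uniq s, s != [::] & forall x, x \in s <-> P x].

Inductive leavitt_gen (D : digraph) : Type :=
| LV of vert D
| LE of edge D
| LEs of edge D.

Section LeavittPathAlgebra.
Variables (k : fieldType) (D : digraph).

Local Notation V v := (Gen (LV v)).
Local Notation "[ f ]" := (Gen (LE f)).
Local Notation "[ f ]*" := (Gen (LEs f)).
Local Notation "x · y" := (Mul x y) (at level 40, left associativity).

Inductive leavitt_rel :
    term k (leavitt_gen D) -> term k (leavitt_gen D) -> Prop :=
| L_vertex u v : leavitt_rel (V u · V v) (if u == v then V u else Zero)
| L_src f : leavitt_rel (V (src f) · [f]) [f]
| L_rng f : leavitt_rel ([f] · V (rng f)) [f]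
| L_rngs f : leavitt_rel (V (rng f) · [f]*) [f]*
| L_srcs f : leavitt_rel ([f]* · V (src f)) [f]*
| L_CK1 f g : leavitt_rel ([f]* · [g]) (if f == g then V (rng f) else Zero)
| L_CK2 v s : enumerates s (fun f => src f = v) ->
    leavitt_rel (V v) (tsum [seq [f] · [f]* | f <- s]).

Definition leavitt := presalg leavitt_rel.

Definition leavitt_deg (x : leavitt_gen D) : int :=
  match x with LV _ => 0 | LE _ => 1 | LEs _ => -1 end.

Definition leavitt_homog : int -> set leavitt :=
  homog leavitt_rel leavitt_deg.

Definition lgen (x : leavitt_gen D) : leavitt := gen leavitt_rel x.

Definition is_path (f : edge D) (s : seq (edge D)) : bool :=
  path (fun e e' => rng e == src e') f s.

Definition leavitt_diag : set leavitt :=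
  lspan [set a : leavitt |
    (exists v, a = lgen (LV v)) \/
    (exists (f : edge D) (s : seq (edge D)), is_path f s /\
       a = (nuprod (lgen (LE f)) [seq lgen (LE e) | e <- s] *
            nuprod_rev (lgen (LEs f)) [seq lgen (LEs e) | e <- s])%g)].

End LeavittPathAlgebra.

Inductive textile_gen (T : textile_system) : Type :=
| TV of vert (tE T)
| TW of vert (tF T)
| TE of edge (tE T)
| TWs of vert (tF T)
| TEs of edge (tE T).

Section TextileAlgebra.
Variables (k : fieldType) (T : textile_system).

Local Notation pV w := (hvert (tp T) w).
Local Notation qV w := (hvert (tq T) w).
Local Notation pE f := (hedge (tp T) f).
Local Notation qE f := (hedge (tq T) f).
Local Notation V v := (Gen (TV v)).
Local Notation W w := (Gen (TW w)).
Local Notation Ws w := (Gen (TWs w)).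
Local Notation E e := (Gen (TE e)).
Local Notation Es e := (Gen (TEs e)).
Local Notation "x · y" := (Mul x y) (at level 40, left associativity).

Inductive textile_rel :
    term k (textile_gen T) -> term k (textile_gen T) -> Prop :=
| T1 u v : textile_rel (V u · V v) (if u == v then V u else Zero)
| T2_src e : textile_rel (V (src e) · E e) (E e)
| T2_rng e : textile_rel (E e · V (rng e)) (E e)
| T2_rngs e : textile_rel (V (rng e) · Es e) (Es e)
| T2_srcs e : textile_rel (Es e · V (src e)) (Es e)
| T2_p w : textile_rel (V (pV w) · W w) (W w)
| T2_q w : textile_rel (W w · V (qV w)) (W w)
| T2_qs w : textile_rel (V (qV w) · Ws w) (Ws w)
| T2_ps w : textile_rel (Ws w · V (pV w)) (Ws w)
| T3_edge e e' :
    textile_rel (Es e · E e') (if e == e' then V (rng e) else Zero)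
| T3_vert w w' :
    textile_rel (Ws w · W w') (if w == w' then V (qV w) else Zero)
| T4_edge u s : enumerates s (fun e => src e = u) ->
    textile_rel (V u) (tsum [seq E e · Es e | e <- s])
| T4_vert v s : enumerates s (fun w => pV w = v) ->
    textile_rel (V v) (tsum [seq W w · Ws w | w <- s])
| T5 f : textile_rel (W (src f) · E (qE f)) (E (pE f) · W (rng f))
| T5s f : textile_rel (Es (qE f) · Ws (src f)) (Ws (rng f) · Es (pE f)).

Definition textile_algebra := presalg textile_rel.

Definition textile_deg (x : textile_gen T) : int :=
  match x with
  | TV _ | TW _ | TWs _ => 0
  | TE _ => 1
  | TEs _ => -1
  end.

Definition textile_homog : int -> set textile_algebra :=
  homog textile_rel textile_deg.

Definition tgen (x : textile_gen T) : textile_algebra := gen textile_rel x.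

Definition letter (x : vert (tF T) + edge (tE T)) : textile_algebra :=
  match x with inl w => tgen (TW w) | inr e => tgen (TE e) end.

Definition letter_star (x : vert (tF T) + edge (tE T)) : textile_algebra :=
  match x with inl w => tgen (TWs w) | inr e => tgen (TEs e) end.

Definition textile_diag : set textile_algebra :=
  subalg_gen [set a : textile_algebra |
    (exists v, tgen (TV v) <> 0 /\ a = (tgen (TV v) * tgen (TV v))%g) \/
    (exists (x : vert (tF T) + edge (tE T))
            (s : seq (vert (tF T) + edge (tE T))),
       nuprod (letter x) (map letter s) <> 0 /\
       a = (nuprod (letter x) (map letter s) *
            nuprod_rev (letter_star x) (map letter_star s))%g)].

End TextileAlgebra.

(* Main.v *)
(* Phi maps a vertex to itself and an edge f of the diagonal graph to
   s(f) q(f) = p(f) r(f).  Unique lifting turns the Cuntz-Krieger relations of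
   A(T) into those of the diagonal graph.

   Injectivity: A(T) acts on functions on pairs (infinite path of the diagonal
   graph, integer), the integer recording the degree, and in this action a
   vertex is nonzero while Phi(f) shifts the degree by 1.  Right multiplication
   by all paths of a large length N loses no information and turns any element
   of L into a combination of real paths; comparing degrees kills its constant
   term, and multiplying by the f^* on the left shortens it.

   Diagonal: the image of the projections of paths is stable under x -> w x w^*
   and x -> e x e^*, because by unique lifting w e is Phi(g) for some g whenever
   it is nonzero, and so is e w.  Hence it contains every projection of a word
   in the letters of A(T). *)

Require Import Defs.
From HB Require Import structures.
From mathcomp Require Import all_boot all_order all_algebra.
From mathcomp Require Import boolp classical_sets functions cardinality.

Set Implicit Arguments.
Unset Strict Implicit.
Unset Printing Implicit Defensive.

Import Order.TTheory GRing.Theory Num.Theory.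
Local Open Scope classical_set_scope.
Local Open Scope ring_scope.

Local Notation "x ⋅ y" := (x * y)%g (at level 40, left associativity).

(** * Nonunital algebras: words, linear spans and generated subalgebras *)

Section NonunitalAlgebra.
Variables (k : fieldType) (A : nuAlgType k).
Implicit Types (x y : A) (s t : seq A).

Lemma nu0mul x : 0 ⋅ x = 0 :> A.
Proof. by have := numulZl (0 : k) (0 : A) x; rewrite !scale0r. Qed.

Lemma numul0 x : x ⋅ 0 = 0 :> A.
Proof. by have := numulZr (0 : k) x (0 : A); rewrite !scale0r. Qed.

Lemma numul_suml I (r : seq I) (P : pred I) (F : I -> A) x :
  (\sum_(i <- r | P i) F i) ⋅ x = \sum_(i <- r | P i) F i ⋅ x.
Proof.
apply: (big_morph (fun y => y ⋅ x)) => [y z|]; first exact: numulDl.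
exact: nu0mul.
Qed.

Lemma numul_sumr I (r : seq I) (P : pred I) (F : I -> A) x :
  x ⋅ (\sum_(i <- r | P i) F i) = \sum_(i <- r | P i) x ⋅ F i.
Proof.
apply: (big_morph (fun y => x ⋅ y)) => [y z|]; first exact: numulDr.
exact: numul0.
Qed.

Lemma nuprod_cons x y s : nuprod x (y :: s) = x ⋅ nuprod y s.
Proof.
rewrite /nuprod /=; elim: s y => //= z s IH y.
by rewrite -[in LHS]mulgA IH.
Qed.

Lemma nuprod_rev_cons x y s : nuprod_rev x (y :: s) = nuprod_rev y s ⋅ x.
Proof.
rewrite /nuprod_rev /=; elim: s y => //= z s IH y.
by rewrite [in LHS]mulgA IH.
Qed.

Lemma nuprod_cat x s y t : nuprod x (s ++ y :: t) = nuprod x s ⋅ nuprod y t.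
Proof.
elim: s x => [|z s IH] x; first exact: nuprod_cons.
by rewrite cat_cons !nuprod_cons IH mulgA.
Qed.

Lemma submod_setP (S : set A) : submod_closed (mem S) <->
  S 0 /\ (forall a x y, S x -> S y -> S (a *: x + y)).
Proof.
split=> -[S0 SD].
  split=> [|a x y Sx Sy]; first exact: (set_mem S0).
  by apply: set_mem; apply: SD; apply: mem_set.
split=> [|a x y /set_mem Sx /set_mem Sy]; first exact: mem_set.
by apply: mem_set; apply: SD.
Qed.

Lemma lspan_ind (S : set A) (P : A -> Prop) :
  P 0 -> (forall a x y, P x -> P y -> P (a *: x + y)) ->
  (forall x, S x -> P x) -> forall x, lspan S x -> P x.
Proof.
by move=> P0 PD SP; apply: (@smallest_sub _ _ _ P) => //; apply/submod_setP.
Qed.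

Lemma lspan_gen (S : set A) x : S x -> lspan S x.
Proof. exact: sub_gen_smallest. Qed.

Lemma lspan0 (S : set A) : lspan S 0.
Proof. by move=> V [/submod_setP[]]. Qed.

Lemma lspanD (S : set A) a x y : lspan S x -> lspan S y -> lspan S (a *: x + y).
Proof.
move=> Sx Sy V VP; have [/submod_setP[_ VD] _] := VP.
by apply: VD; [exact: Sx|exact: Sy].
Qed.

Lemma subalg_gen_ind (S : set A) (P : A -> Prop) :
  P 0 -> (forall a x y, P x -> P y -> P (a *: x + y)) ->
  (forall x y, P x -> P y -> P (x ⋅ y)) ->
  (forall x, S x -> P x) -> forall x, subalg_gen S x -> P x.
Proof.
move=> P0 PD PM SP; apply: (@smallest_sub _ _ _ P) => //; split.
  exact/submod_setP.
by move=> x y /set_mem Px /set_mem Py; apply: mem_set; apply: PM.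
Qed.

Lemma subalg_gen_gen (S : set A) x : S x -> subalg_gen S x.
Proof. exact: sub_gen_smallest. Qed.

Lemma subalg_gen0 (S : set A) : subalg_gen S 0.
Proof. by move=> V [[/submod_setP[]]]. Qed.

Lemma subalg_genD (S : set A) a x y :
  subalg_gen S x -> subalg_gen S y -> subalg_gen S (a *: x + y).
Proof.
move=> Sx Sy V VP; have [[/submod_setP[_ VD] _] _] := VP.
by apply: VD; [exact: Sx|exact: Sy].
Qed.

End NonunitalAlgebra.

(* [starword l ls x s] is α α* for the word α = x s, where [ls] lists the
   adjoints of the letters. *)
Definition starword (k : fieldType) (A : nuAlgType k) I (l ls : I -> A)
    (x : I) (s : seq I) : A :=
  nuprod (l x) (map l s) ⋅ nuprod_rev (ls x) (map ls s).

Lemma starword_cons (k : fieldType) (A : nuAlgType k) I (l ls : I -> A) x y s :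
  starword l ls x (y :: s) = l x ⋅ starword l ls y s ⋅ ls x.
Proof. by rewrite /starword !map_cons nuprod_cons nuprod_rev_cons !mulgA. Qed.

(** * Presented algebras: homomorphisms and representations *)

Section Presentation.
Variables (k : fieldType) (X : Type) (rel : term k X -> term k X -> Prop).
Notation P := (presalg rel).

Lemma pi_add s t : proj rel (Add s t) = proj rel s + proj rel t.
Proof. by rewrite [RHS]proj_add. Qed.

Lemma pi_scale a s : proj rel (Scale a s) = a *: proj rel s.
Proof. by rewrite [RHS]proj_scale. Qed.

Lemma pi_mul s t : proj rel (Mul s t) = proj rel s ⋅ proj rel t.
Proof. by rewrite [RHS]proj_mul. Qed.

Lemma pi_tsum s : proj rel (tsum s) = \sum_(t <- s) proj rel t.
Proof.
elim: s => [|t s IH]; first by rewrite big_nil.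
by rewrite big_cons -IH -pi_add.
Qed.

Lemma pi_rel s t : rel s t -> proj rel s = proj rel t.
Proof. by move=> st; apply/proj_eq/cong_rel. Qed.

Lemma presalg_ind (S : P -> Prop) :
  (forall x, S (gen rel x)) -> S 0 -> (forall x y, S x -> S y -> S (x + y)) ->
  (forall a x, S x -> S (a *: x)) -> (forall x y, S x -> S y -> S (x ⋅ y)) ->
  forall x, S x.
Proof.
move=> Sg S0 SD SZ SM; elim/projW; elim=> // [s Ss t St|a s Ss|s Ss t St].
- by rewrite pi_add; apply: SD.
- by rewrite pi_scale; apply: SZ.
- by rewrite pi_mul; apply: SM.
Qed.

Section UniversalProperty.
Variables (B : nuAlgType k) (h : X -> B).

Fixpoint teval (t : term k X) : B :=
  match t with
  | Gen x => h x
  | Zero => 0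
  | Add s t => teval s + teval t
  | Scale a t => a *: teval t
  | Mul s t => teval s ⋅ teval t
  end.

Lemma teval_tsum s : teval (tsum s) = \sum_(t <- s) teval t.
Proof. by elim: s => [|t s IH]; rewrite ?big_nil ?big_cons //= IH. Qed.

(** Each axiom of the congruence is an identity in [B], so evaluation does not depend on the
    representative of a class. *)
Lemma presalg_universal : (forall s t, rel s t -> teval s = teval t) ->
  exists Phi : {linear P -> B}, {morph Phi : x y / x ⋅ y} /\
    forall x, Phi (gen rel x) = h x.
Proof.
move=> hrel.
have tevalP s t : cong rel s t -> teval s = teval t.
  elim=> {s t} //=.
  - by move=> s t u _ -> _ ->.
  - by move=> s s' t t' _ -> _ ->.
  - by move=> a s s' _ ->.
  - by move=> s s' t t' _ -> _ ->.
  - by move=> *; rewrite addrA.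
  - by move=> *; rewrite addrC.
  - by move=> *; rewrite add0r.
  - by move=> *; rewrite scaleN1r addNr.
  - by move=> *; rewrite scalerA.
  - by move=> *; rewrite scale1r.
  - by move=> *; rewrite scalerDr.
  - by move=> *; rewrite scalerDl.
  - by move=> *; rewrite mulgA.
  - by move=> *; rewrite numulDl.
  - by move=> *; rewrite numulDr.
  - by move=> *; rewrite numulZl.
  - by move=> *; rewrite numulZr.
pose phi (x : P) : B := teval (repr x).
have phiE t : phi (proj rel t) = teval t by apply/tevalP/repr_proj.
have phi_lin : linear phi.
  move=> a; elim/projW=> s; elim/projW=> t.
  by rewrite -pi_scale -pi_add !phiE.
pose L := GRing.isLinear.Build k P B *:%R phi phi_lin.
pose Phi : {linear P -> B} := HB.pack phi L.
exists Phi; split=> [|x]; last exact: phiE.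
elim/projW=> s; elim/projW=> t.
by rewrite /Phi /= -pi_mul !phiE.
Qed.

End UniversalProperty.

Section PartialMapRepresentation.
Variables (S : Type) (tau : X -> S -> option S).

(* Generators act on functions by composition with partial maps, extended by
   0 outside the domain. *)
Fixpoint opeval (t : term k X) (phi : S -> k) (x : S) : k :=
  match t with
  | Gen g => oapp phi 0 (tau g x)
  | Zero => 0
  | Add s t => opeval s phi x + opeval t phi x
  | Scale a t => a * opeval t phi x
  | Mul s t => opeval s (opeval t phi) x
  end.

Lemma opeval_tsum s phi x :
  opeval (tsum s) phi x = \sum_(t <- s) opeval t phi x.
Proof. by elim: s => [|t s IH]; rewrite ?big_nil ?big_cons //= IH. Qed.

(** Operators are bare functions, so linearity has to be proved; right distributivity and right
    scaling in [opeval_cong] rest on it. *)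
Lemma opeval_linear t a phi psi x :
  opeval t (fun y => a * phi y + psi y) x = a * opeval t phi x + opeval t psi x.
Proof.
elim: t x phi psi => [g||s IHs t IHt|b t IH|s IHs t IHt] x phi psi /=.
- by case: (tau g x) => //=; rewrite mulr0 addr0.
- by rewrite mulr0 addr0.
- by rewrite IHs IHt mulrDr addrACA.
- by rewrite IH mulrDr mulrCA.
- by rewrite -IHs; congr opeval; apply/funext => y; rewrite IHt.
Qed.

Lemma opeval0 t x : opeval t (fun=> 0) x = 0.
Proof.
have {1}-> : (fun=> 0 : k) = fun _ : S => -1 * (0 : k) + 0.
  by apply/funext => y; rewrite mulr0 addr0.
by rewrite opeval_linear mulN1r addNr.
Qed.

Lemma opeval_cong : (forall s t, rel s t -> opeval s = opeval t) ->
  forall s t, cong rel s t -> opeval s = opeval t.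
Proof.
move=> hrel s t; elim=> {s t} //=.
- by move=> s t u _ -> _ ->.
- by move=> s s' t t' _ -> _ ->.
- by move=> a s s' _ ->.
- by move=> s s' t t' _ -> _ ->.
- by move=> *; apply/funext => phi; apply/funext => x; rewrite addrA.
- by move=> *; apply/funext => phi; apply/funext => x; rewrite addrC.
- by move=> *; apply/funext => phi; apply/funext => x; rewrite add0r.
- by move=> *; apply/funext => phi; apply/funext => x; rewrite mulN1r addNr.
- by move=> *; apply/funext => phi; apply/funext => x; rewrite mulrA.
- by move=> *; apply/funext => phi; apply/funext => x; rewrite mul1r.
- by move=> *; apply/funext => phi; apply/funext => x; rewrite mulrDr.
- by move=> *; apply/funext => phi; apply/funext => x; rewrite mulrDl.
- move=> s t u; apply/funext => phi; apply/funext => x.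
  have := opeval_linear s 1 (opeval t phi) (opeval u phi) x.
  rewrite mul1r => <-; congr opeval.
  by apply/funext => y; rewrite mul1r.
- move=> a s t; apply/funext => phi; apply/funext => x.
  have := opeval_linear s a (opeval t phi) (fun=> 0) x.
  rewrite opeval0 addr0 => <-; congr opeval.
  by apply/funext => y; rewrite addr0.
Qed.

(** Precomposition reverses the order on points: [a ⋅ b] moves a point first along [a], then along
    [b]. *)
Lemma presalg_representation :
  (forall s t, rel s t -> opeval s = opeval t) ->
  exists act : P -> (S -> k) -> S -> k,
   [/\ forall g phi x, act (gen rel g) phi x = oapp phi 0 (tau g x),
       forall phi x, act 0 phi x = 0,
       forall a b phi x, act (a + b) phi x = act a phi x + act b phi x,
       forall c a phi x, act (c *: a) phi x = c * act a phi x
     & forall a b phi x, act (a ⋅ b) phi x = act a (act b phi) x].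
Proof.
move=> /opeval_cong hcong; exists (fun a => opeval (repr a)).
have actE t : opeval (repr (proj rel t)) = opeval t by apply/hcong/repr_proj.
split; first by move=> g phi x; rewrite actE.
- by move=> phi x; rewrite actE.
- by elim/projW=> s; elim/projW=> t phi x; rewrite -pi_add !actE.
- by move=> c; elim/projW=> s phi x; rewrite -pi_scale !actE.
- by elim/projW=> s; elim/projW=> t phi x; rewrite -pi_mul !actE.
Qed.

End PartialMapRepresentation.

End Presentation.

(** * Finite enumerations, and the defining relations as equations *)

Lemma finite_enum (T : choiceType) : finite_set [set: T] ->
  exists s : seq T, uniq s /\ forall x, x \in s.
Proof.
move=> /finite_seqP[s sT]; exists (undup s).
split=> [|x]; first exact: undup_uniq.
by rewrite mem_undup; have : [set: T] x by []; rewrite sT.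
Qed.

Lemma nonsink_edge (D : digraph) (v : vert D) :
  ~ is_sink v -> exists e : edge D, src e = v.
Proof.
by move=> vn; apply: contrapT => h; apply: vn => e ev; apply: h; exists e.
Qed.

Section PresentedRelations.
Variables (k : fieldType).

Section Leavitt.
Variable D : digraph.
Local Notation V v := (lgen k (LV v)).
Local Notation E f := (lgen k (LE f)).
Local Notation Es f := (lgen k (LEs f)).

Lemma lVV (u v : vert D) : V u ⋅ V v = if u == v then V u else 0.
Proof.
by rewrite /lgen /gen -pi_mul (pi_rel (L_vertex k u v)); case: ifP.
Qed.

Lemma lVE (f : edge D) : V (src f) ⋅ E f = E f.
Proof. by rewrite /lgen /gen -pi_mul (pi_rel (L_src k f)). Qed.

Lemma lEV (f : edge D) : E f ⋅ V (rng f) = E f.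
Proof. by rewrite /lgen /gen -pi_mul (pi_rel (L_rng k f)). Qed.

Lemma lVEs (f : edge D) : V (rng f) ⋅ Es f = Es f.
Proof. by rewrite /lgen /gen -pi_mul (pi_rel (L_rngs k f)). Qed.

Lemma lEsV (f : edge D) : Es f ⋅ V (src f) = Es f.
Proof. by rewrite /lgen /gen -pi_mul (pi_rel (L_srcs k f)). Qed.

Lemma lEsE (f g : edge D) : Es f ⋅ E g = if f == g then V (rng f) else 0.
Proof.
by rewrite /lgen /gen -pi_mul (pi_rel (L_CK1 k f g)); case: ifP.
Qed.

Lemma lCK2 (v : vert D) s : enumerates s (fun f : edge D => src f = v) ->
  V v = \sum_(f <- s) E f ⋅ Es f.
Proof.
move=> vs; rewrite /lgen /gen (pi_rel (L_CK2 k vs)) pi_tsum big_map.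
by apply: eq_bigr => f _; rewrite -pi_mul.
Qed.

Lemma lVE_neq (v : vert D) (f : edge D) : v != src f -> V v ⋅ E f = 0.
Proof. by move=> /negPf vf; rewrite -lVE mulgA lVV vf nu0mul. Qed.

Lemma lEV_neq (v : vert D) (f : edge D) : rng f != v -> E f ⋅ V v = 0.
Proof. by move=> /negPf vf; rewrite -lEV -mulgA lVV vf numul0. Qed.

Lemma lEsV_neq (v : vert D) (f : edge D) : src f != v -> Es f ⋅ V v = 0.
Proof. by move=> /negPf vf; rewrite -lEsV -mulgA lVV vf numul0. Qed.

End Leavitt.

Section Textile.
Variable T : textile_system.
Local Notation p := (hvert (tp T)).
Local Notation q := (hvert (tq T)).
Local Notation pE := (hedge (tp T)).
Local Notation qE := (hedge (tq T)).
Local Notation V v := (tgen k (TV v)).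
Local Notation W w := (tgen k (TW w)).
Local Notation Ws w := (tgen k (TWs w)).
Local Notation E e := (tgen k (@TE T e)).
Local Notation Es e := (tgen k (@TEs T e)).

Lemma tVV (u v : vert (tE T)) : V u ⋅ V v = if u == v then V u else 0.
Proof. by rewrite /tgen /gen -pi_mul (pi_rel (T1 k u v)); case: ifP. Qed.

Lemma tVE e : V (src e) ⋅ E e = E e.
Proof. by rewrite /tgen /gen -pi_mul (pi_rel (T2_src k e)). Qed.

Lemma tEV e : E e ⋅ V (rng e) = E e.
Proof. by rewrite /tgen /gen -pi_mul (pi_rel (T2_rng k e)). Qed.

Lemma tVEs e : V (rng e) ⋅ Es e = Es e.
Proof. by rewrite /tgen /gen -pi_mul (pi_rel (T2_rngs k e)). Qed.

Lemma tEsV e : Es e ⋅ V (src e) = Es e.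
Proof. by rewrite /tgen /gen -pi_mul (pi_rel (T2_srcs k e)). Qed.

Lemma tVW w : V (p w) ⋅ W w = W w.
Proof. by rewrite /tgen /gen -pi_mul (pi_rel (T2_p k w)). Qed.

Lemma tWV w : W w ⋅ V (q w) = W w.
Proof. by rewrite /tgen /gen -pi_mul (pi_rel (T2_q k w)). Qed.

Lemma tEsE e e' : Es e ⋅ E e' = if e == e' then V (rng e) else 0.
Proof. by rewrite /tgen /gen -pi_mul (pi_rel (T3_edge k e e')); case: ifP. Qed.

Lemma tWsW w w' : Ws w ⋅ W w' = if w == w' then V (q w) else 0.
Proof. by rewrite /tgen /gen -pi_mul (pi_rel (T3_vert k w w')); case: ifP. Qed.

Lemma tCK2E u s : enumerates s (fun e => src e = u) ->
  V u = \sum_(e <- s) E e ⋅ Es e.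
Proof.
move=> us; rewrite /tgen /gen (pi_rel (T4_edge k us)) pi_tsum big_map.
by apply: eq_bigr => f _; rewrite -pi_mul.
Qed.

Lemma tCK2W v s : enumerates s (fun w => p w = v) ->
  V v = \sum_(w <- s) W w ⋅ Ws w.
Proof.
move=> vs; rewrite /tgen /gen (pi_rel (T4_vert k vs)) pi_tsum big_map.
by apply: eq_bigr => f _; rewrite -pi_mul.
Qed.

Lemma tWE f : W (src f) ⋅ E (qE f) = E (pE f) ⋅ W (rng f).
Proof. by rewrite /tgen /gen -!pi_mul (pi_rel (T5 k f)). Qed.

Lemma tEsWs f : Es (qE f) ⋅ Ws (src f) = Ws (rng f) ⋅ Es (pE f).
Proof. by rewrite /tgen /gen -!pi_mul (pi_rel (T5s k f)). Qed.

Lemma tWE_neq w e : q w != src e -> W w ⋅ E e = 0.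
Proof.
by move=> /negPf h; rewrite -tVE -tWV -mulgA (mulgA (V _)) tVV h nu0mul numul0.
Qed.

Lemma tEW_neq e w : rng e != p w -> E e ⋅ W w = 0.
Proof.
by move=> /negPf h; rewrite -tVW -tEV -mulgA (mulgA (V _)) tVV h nu0mul numul0.
Qed.

Lemma tWV_neq w v : q w != v -> W w ⋅ V v = 0.
Proof. by move=> /negPf h; rewrite -tWV -mulgA tVV h numul0. Qed.

Lemma tEV_neq e v : rng e != v -> E e ⋅ V v = 0.
Proof. by move=> /negPf h; rewrite -tEV -mulgA tVV h numul0. Qed.

End Textile.
End PresentedRelations.

(** * The homomorphism from the Leavitt path algebra of the diagonal graph *)

Section DiagonalHomomorphism.
Variables (k : fieldType) (T : textile_system).
Local Notation p := (hvert (tp T)).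
Local Notation q := (hvert (tq T)).
Local Notation pE := (hedge (tp T)).
Local Notation qE := (hedge (tq T)).
Local Notation V v := (tgen k (TV v)).
Local Notation W w := (tgen k (TW w)).
Local Notation Ws w := (tgen k (TWs w)).
Local Notation E e := (tgen k (@TE T e)).
Local Notation Es e := (tgen k (@TEs T e)).
Local Notation D := (diagonal_graph T).

Hypothesis left_res : left_resolving T.
Hypothesis finF : finite_graph (tF T).
Hypothesis nosinkE : forall v : vert (tE T), ~ is_sink v.
Hypothesis surj_p : ghom_surjective (tp T).

(** By uniqueness of lifts, an edge is determined by the two letters of s(f) q(f); [p_edge_inj] does
    the same for p(f) r(f). *)
Lemma q_edge_inj f g : src f = src g -> qE f = qE g -> f = g.
Proof.
move=> fg fg'.
have [h [_ hu]] := left_res.2 (src f) (qE f) (esym (hom_src _ _)).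
by rewrite -(hu f) // -(hu g).
Qed.

Lemma p_edge_inj f g : rng f = rng g -> pE f = pE g -> f = g.
Proof.
move=> fg fg'.
have [h [_ hu]] := left_res.1 (rng f) (pE f) (esym (hom_rng _ _)).
by rewrite -(hu f) // -(hu g).
Qed.

Definition dedge f := W (src f) ⋅ E (qE f).
Definition dedges f := Es (qE f) ⋅ Ws (src f).

Lemma dedgeE f : dedge f = E (pE f) ⋅ W (rng f).
Proof. exact: tWE. Qed.

Lemma dedgesE f : dedges f = Ws (rng f) ⋅ Es (pE f).
Proof. exact: tEsWs. Qed.

(* By unique lifting along q, the edges of F with source w correspond to the
   edges of E with source q w. *)
Lemma WWs_sum (s : seq (edge (tF T))) w : uniq s -> (forall f, f \in s) ->
  W w ⋅ Ws w = \sum_(f <- s | src f == w) dedge f ⋅ dedges f.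
Proof.
move=> us sP.
rewrite -[W w]tWV (@tCK2E _ _ _ [seq qE f | f <- s & src f == w]).
  rewrite big_map big_filter numul_sumr numul_suml; apply: eq_bigr => f /eqP <-.
  by rewrite /dedge /dedges !mulgA.
split.
- rewrite map_inj_in_uniq ?filter_uniq // => f g.
  rewrite !mem_filter => /andP[/eqP fw _] /andP[/eqP gw _].
  by apply: q_edge_inj; rewrite fw gw.
- have [e ew] := nonsink_edge (nosinkE (v := q w)).
  have [f [[fw fe] _]] := left_res.2 _ _ (esym ew).
  have : qE f \in [seq qE f | f <- s & src f == w].
    by apply: map_f; rewrite mem_filter fw eqxx sP.
  by case: [seq _ | _ <- _ & _].
- move=> e; split=> [/mapP[f]|ew].
    by rewrite mem_filter => /andP[/eqP <- _] ->; rewrite hom_src.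
  have [f [[fw fe] _]] := left_res.2 _ _ (esym ew).
  by apply/mapP; exists f; rewrite // mem_filter fw eqxx sP.
Qed.

(** The mirror image of [WWs_sum], read through p(f) r(f): unique lifting along [p] matches the
    edges of F over e with the vertices of F over the range of e. *)
Lemma EEs_sum (s : seq (edge (tF T))) e : uniq s -> (forall f, f \in s) ->
  E e ⋅ Es e = \sum_(f <- s | pE f == e) dedge f ⋅ dedges f.
Proof.
move=> us sP.
rewrite -[E e]tEV (@tCK2W _ _ _ [seq rng f | f <- s & pE f == e]).
  rewrite big_map big_filter numul_sumr numul_suml; apply: eq_bigr => f /eqP <-.
  by rewrite dedgeE dedgesE !mulgA.
split.
- rewrite map_inj_in_uniq ?filter_uniq // => f g.
  rewrite !mem_filter => /andP[/eqP fw _] /andP[/eqP gw _] fg.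
  by apply: p_edge_inj; rewrite // fw gw.
(* (T4) requires a nonempty fibre; surjectivity of [p] on vertices provides it. *)
- have [w we] := surj_p.1 (rng e).
  have [f [[fw fe] _]] := left_res.1 _ _ we.
  have : rng f \in [seq rng f | f <- s & pE f == e].
    by apply: map_f; rewrite mem_filter fe eqxx sP.
  by case: [seq _ | _ <- _ & _].
- move=> w; split=> [/mapP[f]|we].
    by rewrite mem_filter => /andP[/eqP <- _] ->; rewrite hom_rng.
  have [f [[fw fe] _]] := left_res.1 _ _ we.
  by apply/mapP; exists f; rewrite // mem_filter fe eqxx sP.
Qed.

Definition diag_gen (x : leavitt_gen D) : textile_algebra k T :=
  match x with LV v => V v | LE f => dedge f | LEs f => dedges f end.

(** Expand v by (T4) over the vertices w of F above v, then each w w^* by [WWs_sum]. As p(s(f)) =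
    s(p(f)), the edges obtained are those leaving v in the diagonal graph. *)
Lemma V_sum (s : seq (edge D)) v : enumerates s (fun f : edge D => src f = v) ->
  V v = \sum_(f <- s) dedge f ⋅ dedges f.
Proof.
have [sF [usF sFP]] := finite_enum finF.1.
have [sE [usE sEP]] := finite_enum finF.2.
case=> us sn sP; rewrite (@tCK2W _ _ _ [seq w <- sF | p w == v]); last first.
  split.
  - exact: filter_uniq.
  - have [w wv] := surj_p.1 v.
    have : w \in [seq w <- sF | p w == v] by rewrite mem_filter sFP wv eqxx.
    by case: [seq _ <- _ | _].
  - by move=> w; rewrite mem_filter sFP andbT; split=> /eqP.
rewrite big_filter.
under eq_bigr => w _ do rewrite (WWs_sum w usE sEP).
(* After the exchange, each edge f meets the single vertex w = s(f). *)
rewrite (exchange_big_dep (fun f : edge (tF T) => p (src f) == v)) /=;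
  last by move=> w f wv /eqP ->.
transitivity (\sum_(f <- sE | p (src f) == v) dedge f ⋅ dedges f).
  apply: eq_bigr => f fv.
  rewrite big_mkcond (bigD1_seq (src f)) //= fv eqxx big1 ?addr0 // => w wf.
  by rewrite (eq_sym (src f)) (negPf wf) andbF.
rewrite -[LHS]big_filter; apply: perm_big; apply: uniq_perm => //.
  exact: filter_uniq.
move=> f; rewrite mem_filter sEP andbT -hom_src.
by apply/eqP/idP => /sP.
Qed.

Lemma diag_hom : exists Phi : {linear leavitt k D -> textile_algebra k T},
  {morph Phi : x y / x ⋅ y} /\ forall x, Phi (lgen k x) = diag_gen x.
Proof.
apply: presalg_universal => _ _ [] /=.
- by move=> u v; rewrite tVV; case: ifP.
- by move=> f; rewrite dedgeE mulgA tVE.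
- by move=> f; rewrite /dedge -mulgA tEV.
- by move=> f; rewrite /dedges mulgA tVEs.
- by move=> f; rewrite dedgesE -mulgA tEsV.
(* In q(f)^* s(f)^* s(g) q(g) the inner pair compares sources and the outer pair compares
   [q]-images; together they decide whether f = g. *)
- move=> f g; rewrite /dedge /dedges -mulgA (mulgA (Ws _)) tWsW.
  have [fg|fg] := eqVneq (src f) (src g); last first.
    rewrite nu0mul numul0; case: eqP => [fg'|//].
    by move: fg; rewrite fg' eqxx.
  rewrite fg -hom_src tVE tEsE; case: eqP => [fg'|fg'].
    by rewrite (q_edge_inj fg fg') eqxx.
  by case: eqP => [fg''|//]; case: fg'; rewrite fg''.
- move=> v s vs; rewrite teval_tsum big_map; exact: V_sum.
Qed.

End DiagonalHomomorphism.

(** * An injectivity criterion for Leavitt path algebras of finite graphs without sinks *)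

Section LeavittInjectivity.
Variables (k : fieldType) (D : digraph).
Local Notation L := (leavitt k D).
Local Notation V v := (lgen k (LV v)).
Local Notation E f := (lgen k (LE f)).
Local Notation Es f := (lgen k (LEs f)).

Variables (vs : seq (vert D)) (fs : seq (edge D)).
Hypotheses (vs_uniq : uniq vs) (vsP : forall v, v \in vs).
Hypotheses (fs_uniq : uniq fs) (fsP : forall f, f \in fs).
Hypothesis nosink : forall v : vert D, ~ is_sink v.

Lemma leavitt_1l (a : L) : (\sum_(v <- vs) V v) ⋅ a = a.
Proof.
have unitl (x : L) u : V u ⋅ x = x -> (\sum_(v <- vs) V v) ⋅ x = x.
  move=> ux; rewrite numul_suml (bigD1_seq u) //= ux big1 ?addr0 // => v vu.
  by rewrite -ux mulgA lVV (negPf vu) nu0mul.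
move: a; apply: presalg_ind => [[v|f|f]||a b ha hb|c a ha|a b ha hb].
- by apply: (unitl _ v); rewrite -[gen _ _]/(V v) lVV eqxx.
- exact: unitl (lVE k f).
- exact: unitl (lVEs k f).
- exact: numul0.
- by rewrite numulDr ha hb.
- by rewrite numulZr ha.
- by rewrite mulgA ha.
Qed.

Lemma leavitt_1r (a : L) : a ⋅ (\sum_(v <- vs) V v) = a.
Proof.
have unitr (x : L) u : x ⋅ V u = x -> x ⋅ (\sum_(v <- vs) V v) = x.
  move=> ux; rewrite numul_sumr (bigD1_seq u) //= ux big1 ?addr0 // => v vu.
  by rewrite -ux -mulgA lVV eq_sym (negPf vu) numul0.
move: a; apply: presalg_ind => [[v|f|f]||a b ha hb|c a ha|a b ha hb].
- by apply: (unitr _ v); rewrite -[gen _ _]/(V v) lVV eqxx.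
- exact: unitr (lEV k f).
- exact: unitr (lEsV k f).
- exact: nu0mul.
- by rewrite numulDl ha hb.
- by rewrite numulZl ha.
- by rewrite -mulgA hb.
Qed.

(** Without sinks, the second Cuntz-Krieger relation is available at every vertex. *)
Lemma lV_sum v : V v = \sum_(f <- fs | src f == v) E f ⋅ Es f :> L.
Proof.
rewrite (@lCK2 _ _ _ [seq f <- fs | src f == v]) ?big_filter //; split.
- exact: filter_uniq.
- have [f fv] := nonsink_edge (nosink (v := v)).
  have : f \in [seq f <- fs | src f == v] by rewrite mem_filter fsP fv eqxx.
  by case: [seq _ <- _ | _].
- by move=> f; rewrite mem_filter fsP andbT; split=> /eqP.
Qed.

(** The unit is the sum of all f f^*, so y is the sum of the (y f) f^*. *)
Lemma leavitt_eq0 (y : L) : (forall f, y ⋅ E f = 0) -> y = 0.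
Proof.
move=> yE; rewrite -(leavitt_1r y) numul_sumr big1 // => v _.
rewrite lV_sum numul_sumr big1 // => f _.
by rewrite mulgA yE nu0mul.
Qed.

(* [real_span n] is the span of the paths of length less than n. *)
Inductive real_span : nat -> L -> Prop :=
| real_span0 n : real_span n 0
| real_spanD n a x y :
    real_span n x -> real_span n y -> real_span n (a *: x + y)
| real_spanV n v : real_span n.+1 (V v)
| real_spanE n f x : real_span n x -> real_span n.+1 (E f ⋅ x).

Lemma real_span_leq m n x : (m <= n)%N -> real_span m x -> real_span n x.
Proof.
move=> mn mx; elim: mx n mn => {m x} [||m v|m f x _ IH].
- by move=> *; apply: real_span0.
- move=> m a x y _ IHx _ IHy n mn.
  by apply: real_spanD; [apply: IHx|apply: IHy].
- by case=> // n _; apply: real_spanV.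
- by case=> // n mn; apply/real_spanE/IH.
Qed.

Lemma real_span_mulV n x v : real_span n x -> real_span n (x ⋅ V v).
Proof.
elim=> {n x} [n|n a x y _ IHx _ IHy|n u|n f x _ IH].
- rewrite nu0mul; exact: real_span0.
- by rewrite numulDl numulZl; apply: real_spanD.
- by rewrite lVV; case: ifP => _; [apply: real_spanV|apply: real_span0].
- by rewrite -mulgA; apply: real_spanE.
Qed.

Lemma real_span_Vmul n x v : real_span n x -> real_span n (V v ⋅ x).
Proof.
elim=> {n x} [n|n a x y _ IHx _ IHy|n u|n f x nx _].
- rewrite numul0; exact: real_span0.
- by rewrite numulDr numulZr; apply: real_spanD.
- by rewrite lVV; case: ifP => _; [apply: real_spanV|apply: real_span0].
- rewrite mulgA; have [->|vf] := eqVneq v (src f).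
    by rewrite lVE; apply: real_spanE.
  by rewrite lVE_neq // nu0mul; apply: real_span0.
Qed.

Lemma real_span_mulE n x f : real_span n x -> real_span n.+1 (x ⋅ E f).
Proof.
elim=> {n x} [n|n a x y _ IHx _ IHy|n u|n g x _ IH].
- rewrite nu0mul; exact: real_span0.
- by rewrite numulDl numulZl; apply: real_spanD.
- have [->|uf] := eqVneq u (src f); last first.
    by rewrite lVE_neq //; apply: real_span0.
  rewrite lVE -lEV; apply: real_spanE; exact: real_spanV.
- by rewrite -mulgA; apply: real_spanE.
Qed.

(** Paths are sorted into vertices and, for the others, by first edge. For [n = 0] there are no
    paths at all. *)
Lemma real_span_decomp n x : real_span n x ->
  if n is n'.+1 then
    exists (c : vert D -> k) (g : edge D -> L),
      (forall f, real_span n' (g f)) /\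
      x = \sum_(v <- vs) c v *: V v + \sum_(f <- fs) E f ⋅ g f
  else x = 0.
Proof.
elim=> {n x} [[|n]||n v|n f x nx _] //.
- exists (fun=> 0), (fun=> 0); split=> [f|]; first exact: real_span0.
  by rewrite !big1 ?addr0 // => i _; rewrite (scale0r, numul0).
- case=> [|n] a x y _ => [-> _ ->|]; first by rewrite scaler0 addr0.
  case=> c [g [gn ->]] _ [c' [g' [gn' ->]]].
  exists (fun v => a * c v + c' v), (fun f => a *: g f + g' f).
  split=> [f|]; first exact: real_spanD.
  rewrite scalerDr addrACA !scaler_sumr -!big_split /=.
  congr (_ + _); apply: eq_bigr => i _; first by rewrite scalerDl scalerA.
  by rewrite numulDr numulZr.
- exists (fun u => (u == v)%:R), (fun=> 0).
  split=> [f|]; first exact: real_span0.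
  rewrite (bigD1_seq v) //= eqxx scale1r !big1 ?addr0 //.
    by move=> f _; rewrite numul0.
  by move=> u /negPf ->; rewrite scale0r.
- exists (fun=> 0), (fun g => if g == f then x else 0); split=> [g|].
    by case: ifP => // _; apply: real_span0.
  rewrite big1 ?add0r => [|v _]; last by rewrite scale0r.
  rewrite (bigD1_seq f) //= eqxx big1 ?addr0 // => g /negPf ->.
  exact: numul0.
Qed.

(** Each ghost edge of y is to be absorbed by one edge multiplied on the right. The length bound may
    depend on the edges chosen. *)
Fixpoint real_after N (y : L) : Prop :=
  if N is N'.+1 then forall f, real_after N' (y ⋅ E f)
  else exists n, real_span n y.

Lemma real_afterD N a x y :
  real_after N x -> real_after N y -> real_after N (a *: x + y).
Proof.
elim: N x y => [|N IH] x y /=.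
  move=> [m mx] [n ny]; exists (maxn m n); apply: real_spanD.
    exact: real_span_leq (leq_maxl m n) mx.
  exact: real_span_leq (leq_maxr m n) ny.
by move=> hx hy f; rewrite numulDl numulZl; apply: IH.
Qed.

Lemma real_after0 N : real_after N 0.
Proof.
elim: N => [|N IH] /=; first by exists 0%N; apply: real_span0.
by move=> f; rewrite nu0mul.
Qed.

Lemma real_after_leq M N y : (M <= N)%N -> real_after M y -> real_after N y.
Proof.
have afterS n : forall x, real_after n x -> real_after n.+1 x.
  elim: n => [|n IH] x.
    by move=> [m mx] f; exists m.+1; apply: real_span_mulE.
  by move=> hx f; apply/IH/hx.
move=> /subnK <-; elim: (N - M)%N => [|d IH] // /IH; exact: afterS.
Qed.

Lemma real_after_mulV N y v : real_after N y -> real_after N (y ⋅ V v).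
Proof.
case: N => [[n ny]|N hy f]; first by exists n; apply: real_span_mulV.
rewrite -mulgA; have [->|vf] := eqVneq v (src f).
  by rewrite lVE; apply: hy.
by rewrite lVE_neq // numul0; apply: real_after0.
Qed.

(** One more edge on the right turns f^* into a vertex or zero. *)
Lemma real_after_mulEs N y f : real_after N y -> real_after N.+1 (y ⋅ Es f).
Proof.
move=> hy g; rewrite -mulgA lEsE; case: ifP => _.
  exact: real_after_mulV.
by rewrite numul0; apply: real_after0.
Qed.

Lemma real_after_all (y : L) : exists N, real_after N y.
Proof.
(* Writing y as 1 y allows a stronger claim: right multiplication by y keeps any z real after enough
   edges. In this form the product case follows by associativity. *)
rewrite -(leavitt_1l y).
have : exists N, real_after N (\sum_(v <- vs) V v).
  exists 0%N, 1%N; elim/big_ind: _ => [|x z hx hz|v _].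
  - exact: real_span0.
  - by rewrite -[x]scale1r; apply: real_spanD.
  - exact: real_spanV.
move: (\sum_(v <- vs) V v : L) => z; move: y z.
have comb a b c : (exists N, real_after N a) -> (exists N, real_after N b) ->
    exists N, real_after N (c *: a + b).
  move=> [M ha] [N hb]; exists (maxn M N); apply: real_afterD.
    exact: real_after_leq (leq_maxl M N) ha.
  exact: real_after_leq (leq_maxr M N) hb.
apply: presalg_ind => [g||a b ha hb|c a ha|a b ha hb] z [N hz].
- case: g => [v|f|f]; first by exists N; apply: real_after_mulV.
    (* The bound is raised by one because multiplying by f uses up one of the edges. *)
    have : real_after N.+1 z by apply: real_after_leq hz.
    by move=> /(_ f); exists N.
  by exists N.+1; apply: real_after_mulEs.
- by exists 0%N; rewrite numul0; apply: real_after0.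
- rewrite numulDr -[z ⋅ a]scale1r; apply: comb; first by apply: ha; exists N.
  by apply: hb; exists N.
- rewrite numulZr -[_ *: _]addr0; apply: comb; first by apply: ha; exists N.
  by exists 0%N; apply: real_after0.
- by rewrite mulgA; apply: hb; apply: ha; exists N.
Qed.

Variables (B : nuAlgType k) (Phi : {linear L -> B}).
Hypothesis PhiM : {morph Phi : x y / x ⋅ y}.

(* The functions [coef y s] stand for the coefficients of the image of [y]
   at [s : S] in each degree. *)
Variables (S : Type) (coef : L -> S -> int -> k).
Hypothesis coef_ker : forall y s n, Phi y = 0 -> coef y s n = 0.
Hypothesis coef_lin : forall a x y s n,
  coef (a *: x + y) s n = a * coef x s n + coef y s n.
Hypothesis coefV : forall v s n, n != 0 -> coef (V v) s n = 0.
Hypothesis coefV0 : forall v, exists s, forall u, coef (V u) s 0 = (u == v)%:R.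
Hypothesis coefE : forall f y s n,
  coef (E f ⋅ y) s n = 0 \/ exists s', coef (E f ⋅ y) s n = coef y s' (n - 1).

Lemma coef0 s n : coef 0 s n = 0.
Proof. by apply: coef_ker; rewrite linear0. Qed.

Lemma coef_sum I (r : seq I) (F : I -> L) s n :
  coef (\sum_(i <- r) F i) s n = \sum_(i <- r) coef (F i) s n.
Proof.
apply: (big_morph (fun x => coef x s n)); last exact: coef0.
by move=> x y; rewrite -[x]scale1r coef_lin scale1r mul1r.
Qed.

(** Stripping an edge lowers the degree by one, so a negative degree stays negative down to a
    vertex, where the coefficient vanishes. *)
Lemma coef_real_span n x s (m : int) : real_span n x -> m < 0 -> coef x s m = 0.
Proof.
move=> nx; elim: nx s m => {n x} [n|n a x y _ IHx _ IHy|n v|n f x _ IH] s m m0.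
- exact: coef0.
- by rewrite coef_lin IHx // IHy // mulr0 addr0.
- by apply: coefV; rewrite lt_eqF.
- have [-> //|[s' ->]] := coefE f x s m.
  by apply: IH; rewrite subr_lt0 (lt_trans m0).
Qed.

Lemma ker_real_span n x : real_span n x -> Phi x = 0 -> x = 0.
Proof.
elim: n x => [|n IH] x /real_span_decomp // [c [g [gn xE]]] Px.
(* In degree 0 the terms f g_f contribute at most coefficients of g_f in degree -1, which vanish;
   the point given by [coefV0] then isolates c_v. *)
have c0 v : c v = 0.
  have [s sP] := coefV0 v.
  have := coef_ker s 0 Px; rewrite xE -[X in X + _]scale1r coef_lin mul1r.
  rewrite !coef_sum [X in _ + X]big1 => [|f _]; last first.
    have [//|[s' ->]] := coefE f (g f) s 0.
    exact: coef_real_span (gn f) _.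
  rewrite (bigD1_seq v) //= -[_ *: V v]addr0 coef_lin coef0 sP eqxx mulr1.
  rewrite big1 ?addr0 // => u /negPf uv.
  by rewrite -[_ *: V u]addr0 coef_lin coef0 sP uv mulr0 addr0.
rewrite big1 ?add0r in xE => [|v _]; last by rewrite c0 scale0r.
(* Multiplying x by f^* recovers only r(f) g_f, not g_f; hence f g_f is rewritten as f r(f) g_f. *)
rewrite xE big1 // => f _; rewrite -lEV -mulgA.
suff -> : V (rng f) ⋅ g f = 0 by rewrite numul0.
have fx : Es f ⋅ x = V (rng f) ⋅ g f.
  rewrite xE numul_sumr (bigD1_seq f) //= mulgA lEsE eqxx.
  rewrite big1 ?addr0 // => h hf.
  by rewrite mulgA lEsE eq_sym (negPf hf) nu0mul.
have gx : Phi (V (rng f) ⋅ g f) = 0 by rewrite -fx PhiM Px numul0.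
apply: IH gx; exact: real_span_Vmul.
Qed.

(** Multiplying on the right by edges stays in the kernel, which reduces the claim to combinations
    of real paths; [leavitt_eq0] brings the conclusion back. *)
Lemma leavitt_injective : injective Phi.
Proof.
suff ker x : Phi x = 0 -> x = 0.
  by move=> x y xy; apply/subr0_eq/ker; rewrite linearB xy subrr.
have [N] := real_after_all x.
elim: N x => [|N IH] x; first by move=> [n]; exact: ker_real_span.
move=> xN Px; apply: leavitt_eq0 => f; apply: IH; first exact: xN.
by rewrite PhiM Px nu0mul.
Qed.

End LeavittInjectivity.

(** * Infinite diagonal paths and the degree coefficients read off from them *)

(* A(T) acts on functions on pairs (x, n), x an infinite path of the diagonal
   graph: the letters prepend to x, read as the infinite word
   w_0 e_0 w_1 e_1 ... with w_i = s(x_i), e_i = q(x_i), and rewritten by (T5);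
   n records the degree. *)
Section InfinitePathRepresentation.
Variables (k : fieldType) (T : textile_system).
Local Notation p := (hvert (tp T)).
Local Notation q := (hvert (tq T)).
Local Notation pE := (hedge (tp T)).
Local Notation qE := (hedge (tq T)).
Local Notation seqF := (nat -> edge (tF T)).
Implicit Types (x y : seqF).

Hypothesis left_res : left_resolving T.

(** The infinite paths of the diagonal graph. *)
Definition dpath x := forall i, rng (qE (x i)) = src (pE (x i.+1)).

(** [d] is a default for when no lift exists; the specifications below show that it never matters on
    compatible data. *)
Definition plift d w e : edge (tF T) := xget d [set f | rng f = w /\ pE f = e].
Definition qlift d w e : edge (tF T) := xget d [set f | src f = w /\ qE f = e].

Lemma plift_spec d w e : p w = rng e ->
  rng (plift d w e) = w /\ pE (plift d w e) = e.
Proof.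
move=> we; rewrite /plift; case: xgetP => [_ -> //|].
by have [f [fP _]] := left_res.1 _ _ we => /(_ f)[].
Qed.

Lemma qlift_spec d w e : q w = src e ->
  src (qlift d w e) = w /\ qE (qlift d w e) = e.
Proof.
move=> we; rewrite /qlift; case: xgetP => [_ -> //|].
by have [f [fP _]] := left_res.2 _ _ we => /(_ f)[].
Qed.

(* x = e y and x = w y, respectively *)
Definition consEP e x y := pE (x 0%N) = e /\
  forall i, src (y i) = rng (x i) /\ qE (y i) = pE (x i.+1).
Definition consWP w x y := src (x 0%N) = w /\
  forall i, rng (y i) = src (x i.+1) /\ pE (y i) = qE (x i).

(** By (T5) x also reads p(x_0) r(x_0) p(x_1) r(x_1) .... Removing p(x_0) and regrouping gives pairs
    r(x_i) p(x_{i+1}), lifted along [q]. [dropW] removes s(x_0) from the other reading and lifts the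
    pairs q(x_i) s(x_{i+1}) along [p]. *)
Definition dropE x i := qlift (x 0%N) (rng (x i)) (pE (x i.+1)).
Definition dropW x i := plift (x 0%N) (src (x i.+1)) (qE (x i)).
Definition consE e x i :=
  plift (x 0%N) (src (x i)) (if i is j.+1 then qE (x j) else e).
Definition consW w x i :=
  qlift (x 0%N) (if i is j.+1 then rng (x j) else w) (pE (x i)).

(** The path condition on x is exactly the compatibility that the lifts need; the lifted edges meet
    because [p] and [q] commute with source and range. *)
Lemma dropE_spec x : dpath x ->
  dpath (dropE x) /\ consEP (pE (x 0%N)) x (dropE x).
Proof.
move=> xd.
have h i : src (dropE x i) = rng (x i) /\ qE (dropE x i) = pE (x i.+1).
  by apply: qlift_spec; rewrite -hom_rng xd.
split; last by split.
by move=> i; rewrite (h i).2 hom_rng hom_src (h i.+1).1.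
Qed.

Lemma dropW_spec x : dpath x ->
  dpath (dropW x) /\ consWP (src (x 0%N)) x (dropW x).
Proof.
move=> xd.
have h i : rng (dropW x i) = src (x i.+1) /\ pE (dropW x i) = qE (x i).
  by apply: plift_spec; rewrite -hom_src xd.
split; last by split.
by move=> i; rewrite (h i.+1).2 hom_rng hom_src (h i).1.
Qed.

Lemma consE_spec e x : dpath x -> src (pE (x 0%N)) = rng e ->
  dpath (consE e x) /\ consEP e (consE e x) x.
Proof.
move=> xd xe.
have h i : rng (consE e x i) = src (x i) /\
    pE (consE e x i) = if i is j.+1 then qE (x j) else e.
  by apply: plift_spec; rewrite -hom_src; case: i => [|i] //; rewrite xd.
split; last by split=> [|i]; rewrite ?(h 0%N).2 // (h i).1 (h i.+1).2.
by move=> i; rewrite (h i.+1).2 hom_rng (h i).1 hom_src.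
Qed.

Lemma consW_spec w x : dpath x -> src (pE (x 0%N)) = q w ->
  dpath (consW w x) /\ consWP w (consW w x) x.
Proof.
move=> xd xw.
have h i : src (consW w x i) = (if i is j.+1 then rng (x j) else w) /\
    qE (consW w x i) = pE (x i).
  by apply: qlift_spec; case: i => [|i]; rewrite -?hom_rng.
split; last by split=> [|i]; rewrite ?(h 0%N).1 // (h i).2 (h i.+1).1.
by move=> i; rewrite (h i).2 hom_rng hom_src (h i.+1).1.
Qed.

(** In x = e y each path determines the other, and likewise in x = w y. Hence [drop] and [cons] are
    shown to be mutually inverse by uniqueness, without computing lifts. *)
Lemma consEP_inj e x x' y : consEP e x y -> consEP e x' y -> x = x'.
Proof.
move=> [xe xy] [xe' xy']; apply/funext => i; apply: (p_edge_inj left_res).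
  by rewrite -(xy i).1 -(xy' i).1.
by case: i => [|i]; [rewrite xe xe'|rewrite -(xy i).2 -(xy' i).2].
Qed.

Lemma consWP_inj w x x' y : consWP w x y -> consWP w x' y -> x = x'.
Proof.
move=> [xe xy] [xe' xy']; apply/funext => i; apply: (q_edge_inj left_res).
  by case: i => [|i]; [rewrite xe xe'|rewrite -(xy i).1 -(xy' i).1].
by rewrite -(xy i).2 -(xy' i).2.
Qed.

Lemma consEP_fun e x y y' : consEP e x y -> consEP e x y' -> y = y'.
Proof.
move=> [_ xy] [_ xy']; apply/funext => i; apply: (q_edge_inj left_res).
  by rewrite (xy i).1 (xy' i).1.
by rewrite (xy i).2 (xy' i).2.
Qed.

Lemma consWP_fun w x y y' : consWP w x y -> consWP w x y' -> y = y'.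
Proof.
move=> [_ xy] [_ xy']; apply/funext => i; apply: (p_edge_inj left_res).
  by rewrite (xy i).1 (xy' i).1.
by rewrite (xy i).2 (xy' i).2.
Qed.

Lemma dropE_consE e x : dpath x -> src (pE (x 0%N)) = rng e ->
  dropE (consE e x) = x.
Proof.
move=> xd xe; have [yd yx] := consE_spec xd xe.
have [_] := dropE_spec yd; rewrite yx.1 => yx'; exact: consEP_fun yx' yx.
Qed.

Lemma dropW_consW w x : dpath x -> src (pE (x 0%N)) = q w ->
  dropW (consW w x) = x.
Proof.
move=> xd xe; have [yd yx] := consW_spec xd xe.
have [_] := dropW_spec yd; rewrite yx.1 => yx'; exact: consWP_fun yx' yx.
Qed.

Lemma src_dropE x : dpath x -> src (pE (dropE x 0%N)) = rng (pE (x 0%N)).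
Proof. by move=> /dropE_spec[_ [_ h]]; rewrite hom_src (h 0%N).1 hom_rng. Qed.

Lemma src_dropW x : dpath x -> src (pE (dropW x 0%N)) = q (src (x 0%N)).
Proof. by move=> /dropW_spec[_ [_ h]]; rewrite (h 0%N).2 hom_src. Qed.

Lemma consE_dropE x : dpath x -> consE (pE (x 0%N)) (dropE x) = x.
Proof.
move=> xd; have [yd xy] := dropE_spec xd.
by have [_ h] := consE_spec yd (src_dropE xd); apply: consEP_inj h xy.
Qed.

Lemma consW_dropW x : dpath x -> consW (src (x 0%N)) (dropW x) = x.
Proof.
move=> xd; have [yd xy] := dropW_spec xd.
by have [_ h] := consW_spec yd (src_dropW xd); apply: consWP_inj h xy.
Qed.

(** Removing the two letters of [x 0], read as s q or as p r, leaves the shifted path; this is (T5)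
    on points. *)
Lemma dropE_dropW x : dpath x -> dropE (dropW x) = fun i => x i.+1.
Proof.
move=> xd; have [yd [_ xy]] := dropW_spec xd; have [_ [_ yz]] := dropE_spec yd.
apply/funext => i; apply: (q_edge_inj left_res).
  by rewrite (yz i).1 (xy i).1.
by rewrite (yz i).2 (xy i.+1).2.
Qed.

Lemma dropW_dropE x : dpath x -> dropW (dropE x) = fun i => x i.+1.
Proof.
move=> xd; have [yd [_ xy]] := dropE_spec xd; have [_ [_ yz]] := dropW_spec yd.
apply/funext => i; apply: (p_edge_inj left_res).
  by rewrite (yz i).1 (xy i.+1).1.
by rewrite (yz i).2 (xy i).2.
Qed.

(** This is the starred half of (T5): both sides are the path f, x_0, x_1, .... *)
Lemma consW_consE f x : dpath x -> src (pE (x 0%N)) = rng (qE f) ->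
  consW (src f) (consE (qE f) x) = consE (pE f) (consW (rng f) x).
Proof.
move=> xd xf; have [yd xy] := consE_spec xd xf.
have yf : src (pE (consE (qE f) x 0%N)) = q (src f) by rewrite xy.1 hom_src.
have [zd yz] := consW_spec yd yf.
have xf' : src (pE (x 0%N)) = q (rng f) by rewrite xf hom_rng.
have [yd' xy'] := consW_spec xd xf'.
have yf' : src (pE (consW (rng f) x 0%N)) = rng (pE f).
  by rewrite hom_src xy'.1 hom_rng.
have [zd' yz'] := consE_spec yd' yf'.
apply/funext => i; case: i => [|i].
  have zf : consW (src f) (consE (qE f) x) 0%N = f.
    by apply: (q_edge_inj left_res); rewrite ?yz.1 // -(yz.2 0%N).2 xy.1.
  rewrite zf; apply: (p_edge_inj left_res); last by rewrite yz'.1.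
  by rewrite -(yz'.2 0%N).1 xy'.1.
transitivity (x i).
  apply: (q_edge_inj left_res); first by rewrite -(yz.2 i).1 (xy.2 i).1.
  by rewrite -(yz.2 i.+1).2 (xy.2 i).2.
apply: (p_edge_inj left_res); first by rewrite -(yz'.2 i.+1).1 -(xy'.2 i).1.
by rewrite -(yz'.2 i).2 (xy'.2 i).2.
Qed.

(** As generators act by precomposition, [TE e] removes the letter e from a point and lowers n. On
    functions it sends the point mass at (y, n) to the one at (e y, n + 1). *)
Definition path_action (g : textile_gen T) (s : seqF * int) :
    option (seqF * int) :=
  let: (x, n) := s in
  let guard (b : bool) t := if `[< dpath x >] && b then Some t else None in
  match g with
  | TV v => guard (src (pE (x 0%N)) == v) (x, n)
  | TW w => guard (src (x 0%N) == w) (dropW x, n)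
  | TE e => guard (pE (x 0%N) == e) (dropE x, n - 1)
  | TWs w => guard (src (pE (x 0%N)) == q w) (consW w x, n)
  | TEs e => guard (src (pE (x 0%N)) == rng e) (consE e x, n + 1)
  end.

Lemma path_action_rel s t : @textile_rel k T s t ->
  opeval path_action s = opeval path_action t.
Proof.
move=> st; apply/funext => phi; apply/funext => -[x n].
(* Off the diagonal paths every generator is undefined, so both sides of each relation vanish. *)
have [xd|xd] := pselect (dpath x); last first.
  have no g : path_action g (x, n) = None by case: g => v /=; rewrite asboolF.
  have no1 g : opeval path_action (Gen g) phi (x, n) = 0.
    by rewrite -[LHS]/(oapp _ 0 (path_action g (x, n))) no.
  have no2 g t' : opeval path_action (Mul (Gen g) t') phi (x, n) = 0.
    by rewrite -[LHS]/(oapp _ 0 (path_action g (x, n))) no.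
  by case: st => *; rewrite ?opeval_tsum ?big_map; try case: ifP => _;
    rewrite ?no2 ?no1 // big1.
have xdb : `[< dpath x >] by apply/asboolP.
have [dEd dEP] := dropE_spec xd; have [dWd dWP] := dropW_spec xd.
case: st => [u v|e|e|e|e|w|w|w|w|e e'|w w'|u l [ul _ lP]|v l [ul _ lP]|f|f] /=.
- have [<-|uv] := eqVneq u v; rewrite /= xdb /=; case: eqP => [xu|//] /=.
    by rewrite xdb xu eqxx.
  by rewrite xdb xu (negPf uv).
- rewrite xdb /=; case: eqP => [xe|xe] /=; first by rewrite xdb.
  by case: eqP => // xe'; case: xe; rewrite xe'.
- rewrite xdb /=; case: eqP => [xe|//] /=.
  by rewrite asboolT // src_dropE // xe eqxx.
- by rewrite xdb /=; case: eqP => [xe|//] /=; rewrite xdb xe eqxx.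
- rewrite xdb /=; case: eqP => [xe|//] /=; have [yd yx] := consE_spec xd xe.
  by rewrite asboolT //= yx.1 eqxx.
- rewrite xdb /=; case: eqP => [xe|xe] /=; first by rewrite xdb.
  by case: eqP => // xe'; case: xe; rewrite hom_src xe'.
- rewrite xdb /=; case: eqP => [xe|//] /=.
  by rewrite asboolT // src_dropW // xe eqxx.
- by rewrite xdb /=; case: eqP => [xe|//] /=; rewrite xdb xe eqxx.
- rewrite xdb /=; case: eqP => [xe|//] /=; have [yd yx] := consW_spec xd xe.
  by rewrite asboolT //= hom_src yx.1 eqxx.
- rewrite xdb /=; case: eqP => [xe|xe] /=; last first.
    by case: ifP => _ //=; rewrite xdb; case: eqP xe.
  have [yd yx] := consE_spec xd xe; rewrite asboolT //= yx.1.
  by case: eqP => // _ /=; rewrite dropE_consE // addrK xdb xe eqxx.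
- rewrite xdb /=; case: eqP => [xe|xe] /=; last first.
    by case: ifP => _ //=; rewrite xdb; case: eqP xe.
  have [yd yx] := consW_spec xd xe; rewrite asboolT //= yx.1.
  by case: eqP => // _ /=; rewrite dropW_consW // xdb xe eqxx.
(* Each e e^* restricts a function to the paths beginning with e, so at most one summand survives at
   x. *)
- rewrite opeval_tsum big_map.
  transitivity (\sum_(e <- l) if pE (x 0%N) == e then phi (x, n) else 0);
    last first.
    apply: eq_bigr => e _ /=; rewrite xdb /=; case: eqP => // xe /=.
    by rewrite asboolT // src_dropE //= xe eqxx /= -xe consE_dropE // subrK.
  rewrite xdb /=; case: eqP => [/lP xl|xl] /=.
    rewrite (bigD1_seq _ xl) //= eqxx big1 ?addr0 // => e.
    by rewrite eq_sym => /negPf ->.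
  by rewrite big_seq big1 // => e /lP el; case: eqP => // xe; rewrite -xe in el.
- rewrite opeval_tsum big_map.
  transitivity (\sum_(w <- l) if src (x 0%N) == w then phi (x, n) else 0);
    last first.
    apply: eq_bigr => w _ /=; rewrite xdb /=; case: eqP => // xe /=.
    by rewrite asboolT // src_dropW //= xe eqxx /= -xe consW_dropW.
  rewrite xdb hom_src /=; case: eqP => [/lP xl|xl] /=.
    rewrite (bigD1_seq _ xl) //= eqxx big1 ?addr0 // => w.
    by rewrite eq_sym => /negPf ->.
  by rewrite big_seq big1 // => w /lP wl; case: eqP => // xw; rewrite -xw in wl.
(* If [x 0] is f, both sides evaluate at the shifted path; otherwise one letter fails to match on
   each side, and both vanish. *)
- rewrite xdb /=; case: (pselect (x 0%N = f)) => [<-|xf].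
    rewrite !eqxx /= !asboolT //= (dWP.2 0%N).2 (dEP.2 0%N).1 !eqxx /=.
    by rewrite dropE_dropW // dropW_dropE.
  have -> : oapp (fun s => oapp phi 0 (path_action (TE (qE f)) s)) 0
      (if src (x 0%N) == src f then Some (dropW x, n) else None) = 0.
    case: eqP => //= xf1; rewrite asboolT // (dWP.2 0%N).2.
    by case: eqP => //= xf2; case: xf; apply: (q_edge_inj left_res).
  case: eqP => //= xf1; rewrite asboolT // (dEP.2 0%N).1.
  by case: eqP => //= xf2; case: xf; apply: (p_edge_inj left_res).
- rewrite xdb /= -(hom_rng (tq T)); case: eqP => //= xf.
  have [yd yx] := consE_spec xd xf.
  have xf' : src (pE (x 0%N)) = q (rng f) by rewrite xf hom_rng.
  have [yd' yx'] := consW_spec xd xf'.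
  rewrite !asboolT //= yx.1 hom_src hom_src yx'.1 hom_rng !eqxx /=.
  by rewrite consW_consE.
Qed.

Variables (Phi : {linear leavitt k (diagonal_graph T) -> textile_algebra k T}).
Hypotheses (PhiM : {morph Phi : x y / x ⋅ y})
  (PhiE : forall g, Phi (lgen k g) = diag_gen k g).
Hypothesis nosinkE : forall v : vert (tE T), ~ is_sink v.
Hypothesis surj_p : ghom_surjective (tp T).

(** An edge of E leaving u lifts through [p], so every vertex has a next diagonal edge; iterating
    the choice gives the path. *)
Lemma dpath_from v : exists x, dpath x /\ src (pE (x 0%N)) = v.
Proof.
have /choice[next nextP] (u : vert (tE T)) : exists f, src (pE f) = u.
  have [e eu] := nonsink_edge (nosinkE (v := u)).
  by have [f fe] := surj_p.2 e; exists f; rewrite fe.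
exists (fun n => iter n (fun f => next (rng (qE f))) (next v)).
by split=> [i|]; rewrite /= nextP.
Qed.

Lemma degree_coefficients :
  exists coef : leavitt k (diagonal_graph T) -> seqF -> int -> k,
  [/\ forall a s n, Phi a = 0 -> coef a s n = 0,
      forall c a b s n, coef (c *: a + b) s n = c * coef a s n + coef b s n,
      forall v s n, n != 0 -> coef (lgen k (LV v)) s n = 0,
      forall v, exists s, forall u, coef (lgen k (LV u)) s 0 = (u == v)%:R
    & forall f a s n, coef (lgen k (LE f) ⋅ a) s n = 0 \/
        exists s', coef (lgen k (LE f) ⋅ a) s n = coef a s' (n - 1)].
Proof.
have [act [actG act0 actD actZ actM]] := presalg_representation path_action_rel.
(* The test function is the indicator of degree 0, constant in the path: vertices only see degree 0,
   and an edge moves the value from degree n to degree n - 1. *)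
pose phi0 (s : seqF * int) : k := (s.2 == 0)%:R.
exists (fun a s n => act (Phi a) phi0 (s, n)); split.
- by move=> a s n ->; rewrite act0.
- by move=> c a b s n; rewrite linearP actD actZ.
- move=> v s n /negPf n0; rewrite PhiE actG /=.
  by case: ifP => //= _; rewrite /phi0 /= n0.
- move=> v; have [x [xd xv]] := dpath_from v; exists x => u.
  by rewrite PhiE actG /= asboolT //= xv (eq_sym v); case: (u == v).
- move=> f a s n; rewrite PhiM PhiE /= dedgeE !actM actG /=.
  case: ifP => _ /=; last by left.
  rewrite actG /=; case: ifP => _ /=; last by left.
  by right; exists (dropW (dropE s)).
Qed.

End InfinitePathRepresentation.

(** * The grading, and the two diagonal subalgebras *)

Section DiagonalSubalgebra.
Variables (k : fieldType) (T : textile_system).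
Local Notation p := (hvert (tp T)).
Local Notation q := (hvert (tq T)).
Local Notation pE := (hedge (tp T)).
Local Notation qE := (hedge (tq T)).
Local Notation V v := (tgen k (TV v)).
Local Notation W w := (tgen k (TW w)).
Local Notation Ws w := (tgen k (TWs w)).
Local Notation E e := (tgen k (@TE T e)).
Local Notation Es e := (tgen k (@TEs T e)).
Local Notation D := (diagonal_graph T).
Local Notation L := (leavitt k D).
Local Notation lV v := (lgen k (@LV D v)).
Local Notation lE f := (lgen k (@LE D f)).
Local Notation lEs f := (lgen k (@LEs D f)).

Hypothesis left_res : left_resolving T.
Hypothesis finF : finite_graph (tF T).
Hypothesis nosinkE : forall v : vert (tE T), ~ is_sink v.
Hypothesis surj_p : ghom_surjective (tp T).

(** Composability of the edges is not recorded: words that are not paths give 0, which is included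
    for this reason. *)
Inductive path_projection : L -> Prop :=
| path_projection0 : path_projection 0
| path_projectionV v : path_projection (lV v)
| path_projectionE f a :
    path_projection a -> path_projection (lE f ⋅ a ⋅ lEs f).

(** First edges either differ, and the product is 0, or cancel, leaving a product inside a
    conjugation. *)
Lemma path_projectionM a b :
  path_projection a -> path_projection b -> path_projection (a ⋅ b).
Proof.
move=> pa; elim: pa b => {a} [|v|f a pa IH] b pb.
- by rewrite nu0mul; apply: path_projection0.
- case: pb => [|u|f b' pb'].
  + by rewrite numul0; apply: path_projection0.
  + by rewrite lVV; case: ifP => _;
      [apply: path_projectionV|apply: path_projection0].
  + rewrite !mulgA; have [->|vf] := eqVneq v (src f).
      by rewrite lVE; apply: path_projectionE.
    by rewrite lVE_neq // !nu0mul; apply: path_projection0.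
- case: pb => [|u|g b' pb'].
  + by rewrite numul0; apply: path_projection0.
  + have [<-|fu] := eqVneq (src f) u.
      by rewrite -mulgA lEsV; apply: path_projectionE.
    by rewrite -mulgA lEsV_neq // numul0; apply: path_projection0.
  + rewrite !mulgA -(mulgA _ (lEs f)) lEsE; case: eqP => [<-|_]; last first.
      by rewrite numul0 !nu0mul; apply: path_projection0.
    (* The vertex r(f) left by f^* f is absorbed into b', which again gives a path projection. *)
    rewrite -(mulgA _ _ b') -(mulgA (lE f)); apply/path_projectionE/IH.
    case: pb' => [|v|h c pc].
    - by rewrite numul0; apply: path_projection0.
    - by rewrite lVV; case: ifP => _;
      [apply: path_projectionV|apply: path_projection0].
    - rewrite !mulgA; have [->|vf] := eqVneq (rng f) (src h).
        by rewrite lVE; apply: path_projectionE.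
      by rewrite lVE_neq // !nu0mul; apply: path_projection0.
Qed.

Lemma starword_projection f s :
  path_projection (starword (fun f => lE f) (fun f => lEs f) f s).
Proof.
elim: s f => [|g s IH] f.
  by rewrite /starword /nuprod /= -lEV; apply/path_projectionE/path_projectionV.
by rewrite starword_cons; apply: path_projectionE.
Qed.

Lemma path_projection_diag a : path_projection a -> leavitt_diag a.
Proof.
suff h : path_projection a -> [\/ a = 0, exists v, a = lV v |
    exists f s, is_path f s /\
      a = starword (fun f => lE f) (fun f => lEs f) f s].
  move=> /h[->|av|[f [s [fs ->]]]]; first exact: lspan0.
    by apply: lspan_gen; left.
  by apply: lspan_gen; right; exists f, s.
elim=> {a} [|v|f a pa [->|[v ->]|[g [s [gs ->]]]]]; first by constructor 1.
- by constructor 2; exists v.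
- by constructor 1; rewrite numul0 nu0mul.
- have [<-|fv] := eqVneq (rng f) v; last first.
    by constructor 1; rewrite lEV_neq // nu0mul.
  by constructor 3; exists f, [::]; rewrite lEV.
- have [fg|fg] := eqVneq (rng f) (src g).
    constructor 3; exists f, (g :: s); rewrite starword_cons; split=> //.
    by apply/andP; split; first exact/eqP.
  constructor 1; case: s gs => [|h s] _.
    rewrite /starword /= /nuprod /= mulgA -[lE g]lVE mulgA.
    by rewrite lEV_neq // !nu0mul.
  by rewrite starword_cons !mulgA -[lE g]lVE mulgA lEV_neq // !nu0mul.
Qed.

Lemma leavitt_diag_ind (P : L -> Prop) :
  P 0 -> (forall a x y, P x -> P y -> P (a *: x + y)) ->
  (forall x, path_projection x -> P x) -> forall x, leavitt_diag x -> P x.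
Proof.
move=> P0 PD Pg; apply: lspan_ind => // x [[v ->]|[f [s [_ ->]]]].
  exact/Pg/path_projectionV.
exact/Pg/starword_projection.
Qed.

(** The diagonal of L is defined as a mere span, whereas that of A(T) is a generated subalgebra;
    closure under products is what reconciles them. *)
Lemma leavitt_diagM (a b : L) :
  leavitt_diag a -> leavitt_diag b -> leavitt_diag (a ⋅ b).
Proof.
move=> da db; move: a da; apply: leavitt_diag_ind => [|c x y dx dy|a pa].
- by rewrite nu0mul; apply: lspan0.
- by rewrite numulDl numulZl; apply: lspanD.
move: b db; apply: leavitt_diag_ind => [|c x y dx dy|b pb].
- by rewrite numul0; apply: lspan0.
- by rewrite numulDr numulZr; apply: lspanD.
by apply: path_projection_diag; apply: path_projectionM.
Qed.

Lemma leavitt_diagE f (a : L) :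
  leavitt_diag a -> leavitt_diag (lE f ⋅ a ⋅ lEs f).
Proof.
move: a; apply: leavitt_diag_ind => [|c x y dx dy|a pa].
- by rewrite numul0 nu0mul; apply: lspan0.
- by rewrite numulDr numulZr numulDl numulZl; apply: lspanD.
by apply: path_projection_diag; apply: path_projectionE.
Qed.

Variables (Phi : {linear L -> textile_algebra k T}).
Hypotheses (PhiM : {morph Phi : x y / x ⋅ y})
  (PhiE : forall g, Phi (lgen k g) = diag_gen k g).

(** Each generator goes to a single word of the same degree, and degrees add under concatenation. *)
Lemma Phi_homog n : Phi @` leavitt_homog n `<=` @textile_homog k T n.
Proof.
pose word m (a : textile_algebra k T) := exists x s,
  \sum_(y <- x :: s) textile_deg y = m /\
  a = nuprod (tgen k x) [seq tgen k y | y <- s].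
have wordM m1 m2 a b : word m1 a -> word m2 b -> word (m1 + m2) (a ⋅ b).
  move=> [x [s [<- ->]]] [y [t [<- ->]]]; exists x, (s ++ y :: t).
  by rewrite -cat_cons big_cat map_cat map_cons nuprod_cat.
have wordG g : word (leavitt_deg g) (Phi (lgen k g)).
  rewrite PhiE; case: g => [v|f|f] /=.
  - by exists (TV v), [::]; rewrite big_seq1.
  - exists (TW (@src (tF T) f)), [:: TE (qE f)].
    by rewrite !big_cons big_nil addr0 add0r.
  - exists (TEs (qE f)), [:: TWs (@src (tF T) f)].
    by rewrite !big_cons big_nil !addr0.
move=> _ [a an <-]; move: a an; apply: lspan_ind.
- by rewrite linear0; apply: lspan0.
- by move=> c a b ha hb; rewrite linearP; apply: lspanD.
move=> _ [g [s [<- ->]]]; apply: lspan_gen.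
suff : word (\sum_(y <- g :: s) leavitt_deg y)
  (Phi (nuprod (lgen k g) [seq lgen k y | y <- s])) by [].
elim: s g => [|h s IH] g; first by rewrite big_seq1; apply: wordG.
by rewrite map_cons nuprod_cons PhiM big_cons; apply: wordM.
Qed.

Lemma Phi_diag (a : L) : leavitt_diag a -> textile_diag (Phi a).
Proof.
move: a; apply: leavitt_diag_ind => [|c x y dx dy|a pa].
- by rewrite linear0; apply: subalg_gen0.
- by rewrite linearP; apply: subalg_genD.
(* Conjugation by s(f) q(f) is conjugation by two successive letters, so images of path projections
   are 0, vertices or projections of words. *)
pose proj_form (b : textile_algebra k T) := [\/ b = 0, exists v, b = V v |
  exists x s, b = starword (@letter k T) (@letter_star k T) x s].
have conjE e b : proj_form b -> proj_form (E e ⋅ b ⋅ Es e).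
  case=> [->|[v ->]|[x [s ->]]]; first by constructor 1; rewrite numul0 nu0mul.
    have [<-|ev] := eqVneq (rng e) v; last first.
      by constructor 1; rewrite tEV_neq // nu0mul.
    by constructor 3; exists (inr e), [::]; rewrite tEV.
  by constructor 3; exists (inr e), (x :: s); rewrite starword_cons.
have conjW w b : proj_form b -> proj_form (W w ⋅ b ⋅ Ws w).
  case=> [->|[v ->]|[x [s ->]]]; first by constructor 1; rewrite numul0 nu0mul.
    have [<-|wv] := eqVneq (q w) v; last first.
      by constructor 1; rewrite tWV_neq // nu0mul.
    by constructor 3; exists (inl w), [::]; rewrite tWV.
  by constructor 3; exists (inl w), (x :: s); rewrite starword_cons.
have : proj_form (Phi a).
  elim: pa => {a} [|v|f a _ IH]; first by constructor 1; rewrite linear0.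
    by constructor 2; exists v; rewrite PhiE.
  have := conjW (@src (tF T) f) _ (conjE (qE f) _ IH).
  by rewrite !PhiM !PhiE /= /dedge /dedges !mulgA.
case=> [->|[v ->]|[x [s ->]]]; first exact: subalg_gen0.
  have [->|v0] := pselect (V v = 0); first exact: subalg_gen0.
  by apply: subalg_gen_gen; left; exists v; rewrite tVV eqxx.
rewrite /starword.
(* Only nonzero words are generators of [textile_diag]; a zero word has zero projection. *)
have [->|s0] := pselect (nuprod (letter k x) (map (@letter k T) s) = 0).
  by rewrite nu0mul; apply: subalg_gen0.
by apply: subalg_gen_gen; right; exists x, s.
Qed.

Local Notation image := (Phi @` @leavitt_diag k D).

Lemma image0 : image 0.
Proof. by exists 0; [exact: lspan0|rewrite linear0]. Qed.

Lemma imageD c a b : image a -> image b -> image (c *: a + b).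
Proof.
move=> [x dx <-] [y dy <-]; exists (c *: x + y); last by rewrite linearP.
exact: lspanD.
Qed.

Lemma image_sum I (r : seq I) (P : pred I) (F : I -> textile_algebra k T) :
  (forall i, image (F i)) -> image (\sum_(i <- r | P i) F i).
Proof.
move=> hF; elim/big_ind: _ => [|x y hx hy|i _] //; first exact: image0.
by rewrite -[x]scale1r; apply: imageD.
Qed.

Lemma imageE f a : image a -> image (dedge k f ⋅ a ⋅ dedges k f).
Proof.
move=> [x dx <-]; exists (lE f ⋅ x ⋅ lEs f); first exact: leavitt_diagE.
by rewrite !PhiM !PhiE.
Qed.

Lemma imageV v : image (V v).
Proof.
exists (lV v); last by rewrite PhiE.
by apply: path_projection_diag; apply: path_projectionV.
Qed.

Lemma image_dedge f : image (dedge k f ⋅ dedges k f).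
Proof.
have -> : dedge k f = dedge k f ⋅ V (rng (qE f)) by rewrite /dedge -mulgA tEV.
exact/imageE/imageV.
Qed.

(** On a vertex, w w^* splits into the terms f f^*. On f b f^*, with f read as p(f) r(f), w p(f) is
    the image of the [q]-lift g, and conjugation by r(f) passes to the shorter b; hence w varies in
    the induction. *)
Lemma image_conjW w a : image a -> image (W w ⋅ a ⋅ Ws w).
Proof.
have [fs [fs_uniq fsP]] := finite_enum finF.2.
move=> [x dx <-]; move: x dx; apply: leavitt_diag_ind => [|c x y hx hy|x px].
- by rewrite linear0 numul0 nu0mul; apply: image0.
- by rewrite linearP numulDr numulZr numulDl numulZl; apply: imageD.
elim: px w => {x} [|v|f x _ IH] w.
- by rewrite linear0 numul0 nu0mul; apply: image0.
- rewrite PhiE /=; have [<-|wv] := eqVneq (q w) v; last first.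
    by rewrite tWV_neq // nu0mul; apply: image0.
  rewrite tWV (WWs_sum k left_res nosinkE w fs_uniq fsP).
  exact/image_sum/image_dedge.
- rewrite !PhiM !PhiE /= dedgeE dedgesE.
  have [wf|wf] := eqVneq (q w) (src (pE f)); last first.
    by rewrite !mulgA tWE_neq // !nu0mul; apply: image0.
  have [g [[gw gf] _]] := left_res.2 _ _ wf.
    have wE : W w ⋅ E (pE f) = dedge k g by rewrite -gw -gf.
  have wEs : Es (pE f) ⋅ Ws w = dedges k g by rewrite -gw -gf.
  by have := imageE g (IH (@rng (tF T) f)); rewrite -wE -wEs !mulgA.
Qed.

(** Here f is read as s(f) q(f): e s(f) is the image of the [p]-lift, and conjugation by q(f) passes
    to the shorter projection. *)
Lemma image_conjE e a : image a -> image (E e ⋅ a ⋅ Es e).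
Proof.
have [fs [fs_uniq fsP]] := finite_enum finF.2.
move=> [x dx <-]; move: x dx; apply: leavitt_diag_ind => [|c x y hx hy|x px].
- by rewrite linear0 numul0 nu0mul; apply: image0.
- by rewrite linearP numulDr numulZr numulDl numulZl; apply: imageD.
elim: px e => {x} [|v|f x _ IH] e.
- by rewrite linear0 numul0 nu0mul; apply: image0.
- rewrite PhiE /=; have [<-|ev] := eqVneq (rng e) v; last first.
    by rewrite tEV_neq // nu0mul; apply: image0.
  rewrite tEV (EEs_sum k left_res surj_p e fs_uniq fsP).
  exact/image_sum/image_dedge.
- rewrite !PhiM !PhiE /= /dedge /dedges.
  have [ef|ef] := eqVneq (rng e) (p (@src (tF T) f)); last first.
    by rewrite !mulgA tEW_neq // !nu0mul; apply: image0.
  have [g [[gf ge] _]] := left_res.1 _ _ (esym ef).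
  have eW : E e ⋅ W (@src (tF T) f) = dedge k g by rewrite -gf -ge dedgeE.
  have eWs : Ws (@src (tF T) f) ⋅ Es e = dedges k g by rewrite -gf -ge dedgesE.
  by have := imageE g (IH (qE f)); rewrite -eW -eWs !mulgA.
Qed.

(** The projection is built from the inside out, starting from the vertex at the end of the last
    letter. *)
Lemma image_starword x s :
  image (starword (@letter k T) (@letter_star k T) x s).
Proof.
have conj y a : image a -> image (letter k y ⋅ a ⋅ letter_star k y).
  by case: y => [w|e]; [apply: image_conjW|apply: image_conjE].
elim: s x => [|y s IH] x; last by rewrite starword_cons; apply/conj/IH.
rewrite /starword /= /nuprod /nuprod_rev /=.
have [v xv] : exists v, letter k x ⋅ V v = letter k x.
  by case: x => [w|e]; [exists (q w); apply: tWV|exists (rng e); apply: tEV].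
by rewrite -xv; apply/conj/imageV.
Qed.

Lemma textile_diag_image a : textile_diag a -> image a.
Proof.
move: a; apply: subalg_gen_ind => [||x y [a da <-] [b db <-]|x].
- exact: image0.
- exact: imageD.
- by exists (a ⋅ b); [apply: leavitt_diagM|rewrite PhiM].
- move=> [[v [_ ->]]|[y [s [_ ->]]]]; last exact: image_starword.
  by rewrite tVV eqxx; apply: imageV.
Qed.

End DiagonalSubalgebra.

Theorem theorem4p7 (k : fieldType) (T : textile_system)
    (left_res : left_resolving T)
    (finF : finite_graph (tF T)) (finE : finite_graph (tE T))
    (nosinkF : forall v : vert (tF T), ~ is_sink v)
    (nosinkE : forall v : vert (tE T), ~ is_sink v)
    (surj_p : ghom_surjective (tp T)) (surj_q : ghom_surjective (tq T))
    (lift_p : s_path_lifting (tp T)) :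
  exists Phi : {linear leavitt k (diagonal_graph T) -> textile_algebra k T},
    [/\ {morph Phi : x y / (x * y)%g},
        injective Phi,
        (forall n : int, Phi @` leavitt_homog n `<=` textile_homog n)
      & set_bij (@leavitt_diag k (diagonal_graph T)) (@textile_diag k T) Phi].
Proof.
have [Phi [PhiM PhiE]] := diag_hom k left_res finF nosinkE surj_p.
have [vs [vs_uniq vsP]] := finite_enum finE.1.
have [fs [fs_uniq fsP]] := finite_enum finF.2.
(* A sink of the diagonal graph would be a sink of E, as every edge of E is some p(f). *)
have nosinkD (v : vert (diagonal_graph T)) : ~ is_sink v.
  move=> v_sink; apply: (nosinkE v) => e ev.
  by have [f fe] := surj_p.2 e; apply: (v_sink f); rewrite /= fe.
have [coef [coef_ker coef_lin coefV coefV0 coefE]] :=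
  degree_coefficients left_res PhiM PhiE nosinkE surj_p.
have Phi_inj : injective Phi.
  exact: (@leavitt_injective _ (diagonal_graph T) vs fs vs_uniq vsP fs_uniq fsP
    nosinkD _ _ PhiM _ coef).
exists Phi; split=> // [n|]; first exact: Phi_homog.
split=> [a da|a b _ _|a da]; first exact: Phi_diag.
  exact: Phi_inj.
exact: (textile_diag_image left_res finF nosinkE surj_p PhiM PhiE da).
Qed.
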